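(* Let $(\mathcal X,\mathsf d_{\mathcal X})$ be a geodesic metric space and $(\mathcal C,\mathsf d_{\mathcal C})$ the cone over it. For three points $z_0=[x_0,r_0]$, $z_1=[x_1,r_1]$, $z_2=[x_2,r_2]\in\mathcal C$, consider a geodesic $\boldsymbol x_{01}\in\mathrm{Geod}(x_0,x_1)$ and the corresponding geodesic $\boldsymbol z_{01}$ in $(\mathcal C,\mathsf d_{\mathcal C})$ from $z_0$ to $z_1$. Assume that for some $x\in\mathcal X$ and $\mathcal D<\frac\pi2$ we have $x_0,x_1,x_2\in B(x,\mathcal D)$. (A) If $(\mathcal X,\mathsf d_{\mathcal X})$ satisfies $K$-semiconcavity along $\boldsymbol x_{01}$ with respect to $x_2$, then $(\mathcal C,\mathsf d_{\mathcal C})$ satisfies $K'$-semiconcavity along $\boldsymbol z_{01}$ with respect to $z_2$, where $K'$ can be chosen to depend continuously only on $K,r_0,r_1,r_2,\mathcal D$. (B) If $x_0\ne x_1$, $r_0=r_1$, and $(\mathcal C,\mathsf d_{\mathcal C})$ satisfies $K$-semiconcavity along $\boldsymbol z_{01}$ with respect to $z_2$, then $(\mathcal X,\mathsf d_{\mathcal X})$ satisfies $K'$-semiconcavity along $\boldsymbol x_{01}$ with respect to $x_2$, where $K'$ can be chosen to depend continuously only on $K,r_0,r_2,\mathcal D$.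
   Context: The cone $\mathcal C$ over $(\mathcal X,\mathsf d_{\mathcal X})$ is the quotient of $\mathcal X\times[0,\infty)$ obtained by identifying all points of $\mathcal X\times\{0\}$ with a single point, the apex; $[x,r]$ is the class of $(x,r)$, and $\mathsf d_{\mathcal C}^2([x_0,r_0],[x_1,r_1])=r_0^2+r_1^2-2r_0r_1\cos(\min\{\pi,\mathsf d_{\mathcal X}(x_0,x_1)\})$. A metric space is geodesic if any two points are joined by a continuous curve whose length equals their distance. $\mathrm{Geod}(x_0,x_1)$ is the set of constant-speed geodesics $[0,1]\to\mathcal X$ from $x_0$ to $x_1$. $B(x,\mathcal D)$ is the metric ball of radius $\mathcal D$ around $x$. Corresponding geodesic: with $\phi=\mathsf d_{\mathcal X}(x_0,x_1)\in(0,\pi)$, $\boldsymbol z_{01}(t)=[\boldsymbol x_{01}(\zeta(t)),\boldsymbol r(t)]$ with $\boldsymbol r(t)\ge 0$, $\boldsymbol r^2(t)=(1-t)^2r_0^2+t^2r_1^2+2t(1-t)r_0r_1\cos\phi$ and $\zeta(t)=\frac1\phi\arccos\big(\frac{(1-t)r_0+t\,r_1\cos\phi}{\boldsymbol r(t)}\big)$ (where $\boldsymbol r(t)=0$, $\boldsymbol z_{01}(t)$ is the apex); if $x_0=x_1$, $\boldsymbol z_{01}(t)=[x_0,(1-t)r_0+tr_1]$. A function $f:[0,1]\to\mathbb R$ is $K$-semiconcave if $t\mapsto f(t)-Kt^2$ is concave. A metric space $(Y,\mathsf d)$ satisfies $K$-semiconcavity along $\boldsymbol y_{01}\in\mathrm{Geod}(y_0,y_1)$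 with respect to the observer $y_2$ if $t\mapsto\mathsf d^2(y_2,\boldsymbol y_{01}(t))$ is $K\,\mathsf d^2(y_0,y_1)$-semiconcave on $[0,1]$.
   Formalization: In (A), continuity of K' is asserted only for r0, r1 > 0 (it fails at 0), though the inequality covers all radii. (B) additionally assumes r0 > 0, r2 > 0 and d_X(x2, x01(t)) ≤ 2D for all t in [0,1]; without these it is false. *)

(* Defs.v *)
(* A metric space is a metricType R over R : realType, with distance mdist and
   open balls ball x e. *)
From HB Require Import structures.
From mathcomp Require Import all_boot all_order all_algebra generic_quotient.
From mathcomp Require Import interval_inference all_classical all_reals all_analysis.
From mathcomp Require Import ring lra.
Set Implicit Arguments.
Unset Strict Implicit.
Unset Printing Implicit Defensive.
Import Order.TTheory GRing.Theory Num.Theory.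
Import numFieldNormedType.Exports.
Local Open Scope classical_set_scope.
Local Open Scope ring_scope.
Local Open Scope quotient_scope.

Section MetricSpaces.
Context {R : realType} {Y : metricType R}.

Definition curve_length (a b : R) (g : R -> Y) : \bar R :=
  ereal_sup [set (\sum_(0 <= i < size s)
      mdist (g (nth b (a :: s) i)) (g (nth b (a :: s) i.+1)))%:E
    | s in itv_partition a b].

(* Geod(y0, y1); only the values of y01 on [0, 1] matter. *)
Definition Geod (y0 y1 : Y) : set (R -> Y) :=
  [set y01 | [/\ y01 0 = y0, y01 1 = y1 &
     forall s t : R, 0 <= s <= 1 -> 0 <= t <= 1 ->
       mdist (y01 s) (y01 t) = `|s - t| * mdist y0 y1]].

End MetricSpaces.

Definition geodesic_space {R : realType} (Y : metricType R) : Prop :=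
  forall y0 y1 : Y, exists g : R -> Y,
    [/\ {within `[0, 1], continuous g}, g 0 = y0, g 1 = y1 &
        curve_length 0 1 g = (mdist y0 y1)%:E].

(* Concavity of t |-> f t - K t^2 on [0, 1], as convexity of its opposite. *)
Definition semiconcave {R : realType} (K : R) (f : R -> R) : Prop :=
  convex_function (`[0, 1]%classic : set R^o) (fun t => - (f t - K * t ^+ 2)).

Definition semiconcave_along {R : realType} {Y : metricType R} (K : R)
    (y0 y1 : Y) (y01 : R -> Y) (y2 : Y) : Prop :=
  semiconcave (K * mdist y0 y1 ^+ 2) (fun t => mdist y2 (y01 t) ^+ 2).

Section Cone.
Context {R : realType} (X : metricType R).
Implicit Types (x y : X) (r s : {nonneg R}) (p q : X * {nonneg R}).

Definition cone_rel p q : bool :=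
  (p == q) || (p.2%:num == 0) && (q.2%:num == 0).

Lemma cone_rel_refl : reflexive cone_rel.
Proof. by move=> p; rewrite /cone_rel eqxx. Qed.

Lemma cone_rel_sym : symmetric cone_rel.
Proof. by move=> p q; rewrite /cone_rel eq_sym andbC. Qed.

Lemma cone_rel_trans : transitive cone_rel.
Proof.
move=> q p u; rewrite /cone_rel => /orP[/eqP->//|/andP[p0 q0]].
by case/orP=> [/eqP<-|/andP[_ u0]]; rewrite p0 ?q0 ?u0 orbT.
Qed.

Canonical cone_equiv_rel :=
  EquivRel cone_rel cone_rel_refl cone_rel_sym cone_rel_trans.

Definition cone : Type := {eq_quot cone_equiv_rel}.

HB.instance Definition _ := Choice.on cone.
HB.instance Definition _ := EqQuotient.on cone.

(* The class [x, r]. *)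
Definition cone_pt x r : cone := \pi_cone (x, r).

Definition cone_pre_dist p q : R :=
  Num.sqrt (p.2%:num ^+ 2 + q.2%:num ^+ 2
            - 2 * p.2%:num * q.2%:num * cos (Num.min pi (mdist p.1 q.1))).

Definition cone_dist (z w : cone) : R := cone_pre_dist (repr z) (repr w).

Lemma cone_pre_dist_rel p p' q q' :
  cone_rel p p' -> cone_rel q q' -> cone_pre_dist p q = cone_pre_dist p' q'.
Proof.
rewrite /cone_rel /cone_pre_dist.
case/orP=> [/eqP<-|/andP[/eqP-> /eqP->]];
  case/orP=> [/eqP<-|/andP[/eqP-> /eqP->]] //; congr Num.sqrt; ring.
Qed.

Lemma cone_rel_repr p : cone_rel (repr (\pi_cone p)) p.
Proof.
by have /eqmodP := reprK (\pi_cone p).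
Qed.

Lemma cone_dist_pi p q : cone_dist (\pi_cone p) (\pi_cone q) = cone_pre_dist p q.
Proof. exact: cone_pre_dist_rel (cone_rel_repr p) (cone_rel_repr q). Qed.

Lemma cone_angle x y :
  (0 : R) <= Num.min pi (mdist x y) <= pi.
Proof. by rewrite ge_min lexx /= le_min pi_ge0 mdist_ge0. Qed.

Lemma cone_radicand_ge0 (a b c : R) : 0 <= a -> 0 <= b ->
  0 <= a ^+ 2 + b ^+ 2 - 2 * a * b * cos c.
Proof.
move=> a0 b0; have ab0 : 0 <= a * b by rewrite mulr_ge0.
have := cos_le1 c; have := sqr_ge0 (a - b); nra.
Qed.

Lemma cone_dist_sym z w : cone_dist z w = cone_dist w z.
Proof.
rewrite /cone_dist /cone_pre_dist [mdist (repr w).1 _]metric_sym.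
by congr Num.sqrt; ring.
Qed.

Lemma cone_distxx z : cone_dist z z = 0.
Proof.
rewrite /cone_dist /cone_pre_dist mdistxx min_r ?pi_ge0// cos0.
by rewrite -[RHS]sqrtr0; congr Num.sqrt; ring.
Qed.

Lemma cone_dist_positivity z w : cone_dist z w = 0 -> z = w.
Proof.
rewrite /cone_dist => zw0; rewrite -[z]reprK -[w]reprK; move: zw0.
move: (repr z) (repr w) => [x r] [y s] /= /eqP.
rewrite /cone_pre_dist sqrtr_eq0 /= => le0.
apply/eqmodP; rewrite /= /cone_rel.
have /andP[a0 api] := cone_angle x y.
set a := Num.min _ _ in le0 a0 api.
have rs0 : 0 <= r%:num * s%:num :> R by rewrite mulr_ge0.
have /eqP rs : r%:num - s%:num == 0 :> R.
  rewrite -sqrf_eq0 eq_le sqr_ge0 andbT.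
  by have := cos_le1 a; nra.
have {}rs : r%:num = s%:num :> R by lra.
have [r0|r0] := eqVneq (r%:num) (0 : R); first by rewrite -rs r0 eqxx orbT.
rewrite orbF; apply/eqP; congr (_, _); last exact/val_inj.
have r2 : 0 < r%:num ^+ 2 :> R by rewrite exprn_gt0// lt_neqAle eq_sym r0/=.
have c1 : cos a = cos 0.
  rewrite cos0; apply/eqP; rewrite eq_le cos_le1 /=.
  rewrite leNgt; apply/negP => c1; rewrite -rs in le0; nra.
have /mdist_positivity// : mdist x y = 0.
have az : a = 0 by apply: cos_inj c1; rewrite in_itv/= ?a0 ?api// lexx pi_ge0.
by move: az; rewrite /a; case: leP => // _ /eqP; rewrite gt_eqF ?pi_gt0.
Qed.

Lemma cone_planar_triangle (a b c : R) (u v : R) : 0 <= a -> 0 <= b -> 0 <= c ->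
  Num.sqrt (a ^+ 2 + c ^+ 2 - 2 * a * c * cos (u + v)) <=
  Num.sqrt (a ^+ 2 + b ^+ 2 - 2 * a * b * cos u) +
  Num.sqrt (b ^+ 2 + c ^+ 2 - 2 * b * c * cos v).
Proof.
move=> a0 b0 c0.
set A := a ^+ 2 + b ^+ 2 - _; set B := b ^+ 2 + c ^+ 2 - _.
have A0 : 0 <= A by exact: cone_radicand_ge0.
have B0 : 0 <= B by exact: cone_radicand_ge0.
rewrite -ler_sqr ?nnegrE ?addr_ge0 ?sqrtr_ge0// sqrrD.
rewrite !sqr_sqrtr ?cone_radicand_ge0//.
pose P := - a * c * cos (u + v) + b * a * cos u + b * c * cos v - b ^+ 2.
have PP : P <= Num.sqrt A * Num.sqrt B.
  rewrite -sqrtrM//; apply: le_trans (ler_norm P) _.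
  rewrite -sqrtr_sqr ler_wsqrtr// -subr_ge0.
  pose Q := a * sin u * (b - c * cos v) + (b - a * cos u) * c * sin v.
  suff -> : A * B - P ^+ 2 = Q ^+ 2 by exact: sqr_ge0.
  rewrite /A /B /P /Q cosD.
  have hu := cos2Dsin2 u; have hv := cos2Dsin2 v.
  set cu := cos u in hu *; set su := sin u in hu *.
  set cv := cos v in hv *; set sv := sin v in hv *.
  have h1 : su ^+ 2 = 1 - cu ^+ 2 by lra.
  have h2 : sv ^+ 2 = 1 - cv ^+ 2 by lra.
  by ring: h1 h2.
suff -> : a ^+ 2 + c ^+ 2 - 2 * a * c * cos (u + v) = A + P *+ 2 + B by lra.
by rewrite /A /B /P; ring.
Qed.

Lemma cone_dist_triangle w z v :
  cone_dist z v <= cone_dist z w + cone_dist w v.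
Proof.
rewrite /cone_dist; move: (repr z) (repr w) (repr v) => [x r] [y s] [x2 t].
rewrite /cone_pre_dist /=.
have /andP[a0 api] := cone_angle x y.
have /andP[b0 bpi] := cone_angle y x2.
have /andP[c0 cpi] := cone_angle x x2.
have cab : Num.min pi (mdist x x2) <=
    Num.min pi (mdist x y) + Num.min pi (mdist y x2) :> R.
  have := metric_triangle x y x2; have := mdist_ge0 x y; have := mdist_ge0 y x2.
  have := @pi_ge0 R.
  by case: (leP pi (mdist x x2)); case: (leP pi (mdist x y));
     case: (leP pi (mdist y x2)); lra.
set a := Num.min pi (mdist x y) in a0 api cab *.
set b := Num.min pi (mdist y x2) in b0 bpi cab *.
set c := Num.min pi (mdist x x2) in c0 cpi cab *.
have mono (p q e f : R) : 0 <= p -> 0 <= q -> 0 <= e -> f <= pi -> e <= f ->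
    Num.sqrt (p ^+ 2 + q ^+ 2 - 2 * p * q * cos e) <=
    Num.sqrt (p ^+ 2 + q ^+ 2 - 2 * p * q * cos f).
  move=> p0 q0 e0 fpi ef; apply: ler_wsqrtr; rewrite lerD2l lerN2.
  apply: ler_wpM2l; first by rewrite !mulr_ge0.
  by rewrite leNgt ltr_cos ?in_itv/= -?leNgt// ?e0 ?fpi ?(le_trans ef) ?(le_trans e0).
have [abpi|abpi] := leP (a + b) pi.
  apply: le_trans (mono _ _ _ (a + b) _ _ _ _ _) _ => //.
  exact: cone_planar_triangle.
apply: le_trans (mono _ _ _ pi _ _ _ _ _) _ => //.
have -> : pi = a + (pi - a) by ring.
apply: le_trans (@cone_planar_triangle _ s%:num _ _ _ _ _ _) _ => //.
by rewrite lerD2l; apply: mono => //; rewrite ?subr_ge0//; lra.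
Qed.

HB.instance Definition _ := isMetric.Build R cone cone_distxx
  cone_dist_positivity cone_dist_sym cone_dist_triangle.

Lemma mdist_cone_pt x0 r0 x1 r1 :
  mdist (cone_pt x0 r0) (cone_pt x1 r1) =
  Num.sqrt (r0%:num ^+ 2 + r1%:num ^+ 2
            - 2 * r0%:num * r1%:num * cos (Num.min pi (mdist x0 x1))).
Proof. exact: cone_dist_pi. Qed.

(* The curve z01 associated with x01, for mdist x0 x1 < pi.  The absolute value
   only serves to land in {nonneg R}: on [0, 1] it is the identity.  When the
   radius vanishes the first coordinate is irrelevant, the class being the apex. *)
Definition cone_geodesic x0 r0 x1 r1 (x01 : R -> X) (t : R) : cone :=
  if x0 == x1 then
    cone_pt x0 `|(1 - t) * r0%:num + t * r1%:num|%:nng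
  else
    let phi := mdist x0 x1 in
    let r : {nonneg R} :=
      (Num.sqrt ((1 - t) ^+ 2 * r0%:num ^+ 2 + t ^+ 2 * r1%:num ^+ 2
        + 2 * t * (1 - t) * r0%:num * r1%:num * cos phi))%:nng in
    let zeta :=
      phi^-1 * acos (((1 - t) * r0%:num + t * r1%:num * cos phi) / r%:num) in
    cone_pt (x01 zeta) r.

End Cone.

Arguments cone_pt {R X} x r.
Arguments cone_geodesic {R X} x0 r0 x1 r1 x01 t.

(* Main.v *)
Require Import Defs.
From HB Require Import structures.
From mathcomp Require Import all_boot all_order all_algebra.
From mathcomp Require Import interval_inference all_classical all_reals all_analysis.
From mathcomp Require Import ring lra.
Set Implicit Arguments.
Unset Strict Implicit.
Unset Printing Implicit Defensive.
Import Order.TTheory GRing.Theory Num.Theory.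
Import numFieldNormedType.Exports.
Local Open Scope classical_set_scope.
Local Open Scope ring_scope.

(* Let d be the distance to x2 along x01, parametrized by the angle, and
   u = cos (min pi d).  In polar coordinates (n, angle) the curve z01 is a
   straight segment P of the plane, t |-> n(t)^2 - t^2 d_C(z0, z1)^2 is affine,
   and d_C(z2, z01)^2 = r2^2 + n^2 - 2 r2 n u.  So everything reduces to
   comparing the semiconvexity of n u in t with that of u in the angle.  If P
   lies on [P0, P1] with angles a and b on either side, then "n u lies below its
   chord" reads sin (a + b) u <= sin b u0 + sin a u1, whereas "u lies below its
   chord" reads (a + b) u <= b u0 + a u1; the normalized weights differ by
   O(a b), and |u| <= 1.  Finally u is a convex nonincreasing function of d^2,
   with bounded second derivative and with slope bounded away from 0 on
   [0, (2 D)^2]: the first properties turn semiconcavity of d^2 into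
   semiconvexity of u (part A), the others turn it back, as d is 1-Lipschitz
   in the angle (part B). *)

(** * Trigonometric inequalities *)

Section Trig.
Context {R : realType}.
Implicit Types (a b x y : R) (f df : R -> R).

(** Engine of the Taylor-type bounds that follow: the difference of the two sides vanishes at the
    left end and has a nonnegative derivative. *)
Lemma is_derive_ge0_le f df a b : (forall x, is_derive x 1 f (df x)) ->
  (forall x, a < x < b -> 0 <= df x) -> a <= b -> f a <= f b.
Proof.
move=> fdf df0; rewrite le_eqVlt => /predU1P[->//|ab].
have cf : {within `[a, b], continuous f}.
  by apply: derivable_within_continuous => x _; have [] := fdf x.
have [c + fE] := MVT ab (fun x _ => fdf x) cf.
by rewrite in_itv/= => /df0 dfc; rewrite -subr_ge0 fE mulr_ge0// subr_ge0 ltW.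
Qed.

Lemma sin_le x : 0 <= x -> sin x <= x.
Proof.
move=> x0; rewrite -subr_ge0.
pose f y := y - sin y.
have -> : 0 = f 0 by rewrite /f sin0 subrr.
apply: (@is_derive_ge0_le f (fun y => 1 - cos y)) => //.
Qed.

Lemma cos_ge x : 0 <= x -> 1 - x ^+ 2 / 2 <= cos x.
Proof.
move=> x0; rewrite -subr_ge0.
pose f y := cos y - (1 - y ^+ 2 / 2).
have -> : 0 = f 0 by rewrite /f cos0; ring.
apply: (@is_derive_ge0_le f (fun y => y - sin y)) => // [y|y /andP[y0 _]].
  apply: is_derive_eq. rewrite /GRing.scale/=; lra.
by rewrite subr_ge0 sin_le// ltW.
Qed.

Lemma sin_ge x : 0 <= x -> x - x ^+ 3 / 6 <= sin x.
Proof.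
move=> x0; rewrite -subr_ge0.
pose f y := sin y - (y - y ^+ 3 / 6).
have -> : 0 = f 0 by rewrite /f sin0; ring.
apply: (@is_derive_ge0_le f (fun y => cos y - (1 - y ^+ 2 / 2))) => //
  [y|y /andP[y0 _]].
  by apply: is_derive_eq; rewrite /GRing.scale/=; field.
by rewrite subr_ge0 cos_ge// ltW.
Qed.

Lemma mul_cos_le_sin x : 0 <= x <= pi -> x * cos x <= sin x.
Proof.
move=> /andP[x0 xpi]; rewrite -subr_ge0.
pose f y := sin y - y * cos y.
have -> : 0 = f 0 by rewrite /f sin0; ring.
apply: (@is_derive_ge0_le f (fun y => y * sin y)) => // [y|y /andP[y0 yx]].
  by apply: is_derive_eq; rewrite /GRing.scale/=; ring.
by rewrite mulr_ge0 ?ltW// sin_gt0_pi// y0 (lt_le_trans yx).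
Qed.

Lemma sin_sub_mul_cos_le x : 0 <= x -> sin x - x * cos x <= x ^+ 3 / 3.
Proof.
move=> x0; rewrite -subr_ge0.
pose f y := y ^+ 3 / 3 - (sin y - y * cos y).
have -> : 0 = f 0 by rewrite /f sin0; ring.
apply: (@is_derive_ge0_le f (fun y => y * (y - sin y))) => //
  [y|y /andP[y0 yx]].
  by apply: is_derive_eq; rewrite /GRing.scale/=; field.
by rewrite mulr_ge0 ?subr_ge0 ?sin_le ?ltW.
Qed.

(** Monotonicity of [sin x / x] with denominators cleared. The derivative [sin a - a * cos y] is
    nonnegative at [y = a] by [mul_cos_le_sin], and [cos] decreases on [[0, pi]]. *)
Lemma sin_div_antitone a b : 0 <= a -> a <= b -> b <= pi ->
  a * sin b <= b * sin a.
Proof.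
move=> a0 ab bpi; rewrite -subr_ge0.
pose f y := y * sin a - a * sin y.
have -> : 0 = f a by rewrite /f subrr.
apply: (@is_derive_ge0_le f (fun y => sin a - a * cos y)) => //
  [y|y /andP[ay yb]].
  by apply: is_derive_eq; rewrite /GRing.scale/=; ring.
have /mul_cos_le_sin : 0 <= a <= pi by rewrite a0 (le_trans ab).
rewrite -subr_ge0 => /le_trans; apply; rewrite lerD2l lerN2 ler_wpM2l//.
have y0 : 0 <= y by rewrite (le_trans a0)// ltW.
have ypi : y <= pi by rewrite (le_trans (ltW yb)).
by rewrite leNgt ltr_cos ?in_itv/= ?a0 ?y0 ?(le_trans ab)// -leNgt ltW.
Qed.

(** Two differentiations: the difference vanishes at [a], its derivative [df] is nonnegative at [a]
    by [sin_sub_mul_cos_le], and [df] has derivative [a * (y - sin y)]. *)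
Lemma sin_div_lipschitz a b : 0 <= a -> a <= b ->
  b * sin a - a * sin b <= a * b * (b ^+ 2 - a ^+ 2) / 6.
Proof.
move=> a0 ab; rewrite -subr_ge0.
pose f y := a * y * (y ^+ 2 - a ^+ 2) / 6 - (y * sin a - a * sin y).
pose df y := a * (3 * y ^+ 2 - a ^+ 2) / 6 - (sin a - a * cos y).
have -> : 0 = f a by rewrite /f; ring.
apply: (@is_derive_ge0_le f df) => // [y|y /andP[ay yb]].
  by apply: is_derive_eq; rewrite /df /GRing.scale/=; field.
apply: (@le_trans _ _ (df a)).
  by have := sin_sub_mul_cos_le a0; rewrite /df; lra.
apply: (@is_derive_ge0_le df (fun y => a * (y - sin y))) (ltW ay).
  by move=> z; rewrite /df; apply: is_derive_eq; rewrite /GRing.scale/=; field.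
move=> z /andP[az _]; rewrite mulr_ge0// subr_ge0 sin_le//.
by rewrite ltW// (le_lt_trans a0).
Qed.

(* Cauchy's mean value theorem for [cos x] against [x ^+ 2]. *)
Lemma cos_sqr_slope a b : 0 <= a -> a < b ->
  exists2 c, a < c < b & 2 * c * (cos a - cos b) = sin c * (b ^+ 2 - a ^+ 2).
Proof.
move=> a0 ab.
pose f y := (cos y - cos a) * (b ^+ 2 - a ^+ 2)
  - (cos b - cos a) * (y ^+ 2 - a ^+ 2).
pose df y := - sin y * (b ^+ 2 - a ^+ 2) - (cos b - cos a) * (2 * y).
have fdf y : is_derive y 1 f (df y).
  by apply: is_derive_eq; rewrite /df /GRing.scale/=; ring.
have cf : {within `[a, b], continuous f}.
  by apply: derivable_within_continuous => x _; have [] := fdf x.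
have [c + fE] := MVT ab (fun x _ => fdf x) cf.
rewrite in_itv/= => cab; exists c => //.
have : df c = 0.
  have : df c * (b - a) = 0 by rewrite -fE /f; ring.
  move=> /eqP; rewrite mulf_eq0 [b - a == 0]subr_eq0 (gt_eqF ab) orbF.
  by move=> /eqP.
by rewrite /df; lra.
Qed.

(** The limit 1 at 0 is put in by hand, since division by 0 would give 0; monotonicity and the
    Lipschitz bound then hold down to 0. *)
Definition sinc x := if x == 0 then 1 else sin x / x.

Lemma mul_sinc x : x * sinc x = sin x.
Proof.
rewrite /sinc; case: eqVneq => [->|x0]; first by rewrite mul0r sin0.
by rewrite mulrC divfK.
Qed.

Lemma sinc_le1 x : 0 <= x -> sinc x <= 1.
Proof.
rewrite /sinc; case: eqVneq => [//|x_neq0 x0].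
by rewrite ler_pdivrMr ?mul1r ?sin_le// lt0r x_neq0.
Qed.

Lemma sinc_gt0 x : 0 <= x < pi -> 0 < sinc x.
Proof.
case/andP=> x0 xpi; rewrite /sinc; case: eqVneq => [_|x_neq0].
  exact: ltr01.
by rewrite divr_gt0 ?sin_gt0_pi ?lt0r ?x_neq0 ?x0.
Qed.

Lemma sinc_antitone a b : 0 <= a -> a <= b -> b <= pi -> sinc b <= sinc a.
Proof.
move=> a0 ab bpi.
have [->|a_neq0] := eqVneq a 0.
  by rewrite [sinc 0]/sinc eqxx sinc_le1// (le_trans a0).
have a_gt0 : 0 < a by rewrite lt0r a_neq0.
have b_gt0 : 0 < b by rewrite (lt_le_trans a_gt0).
rewrite /sinc !gt_eqF// ler_pdivrMr// mulrAC ler_pdivlMr//.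
by rewrite mulrC (mulrC (sin a)) sin_div_antitone.
Qed.

Lemma sinc_lipschitz a b : 0 <= a -> a <= b ->
  sinc a - sinc b <= (b ^+ 2 - a ^+ 2) / 6.
Proof.
move=> a0 ab; have b0 := le_trans a0 ab.
have [b_eq0|b_neq0] := eqVneq b 0.
  have -> : a = b by apply/eqP; rewrite eq_le ab b_eq0.
  by rewrite !subrr mul0r.
have b_gt0 : 0 < b by rewrite lt0r b_neq0.
rewrite {2}/sinc (negPf b_neq0).
have [->|a_neq0] := eqVneq a 0.
  rewrite /sinc eqxx -(ler_pM2l b_gt0) mulrBr mulr1 mulrC divfK//.
  by have := sin_ge b0; rewrite expr0n/=; lra.
have a_gt0 : 0 < a by rewrite lt0r a_neq0.
rewrite /sinc (negPf a_neq0) -(ler_pM2l (mulr_gt0 a_gt0 b_gt0)).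
have -> : a * b * (sin a / a - sin b / b) = b * sin a - a * sin b.
  by field; rewrite a_neq0 b_neq0.
by rewrite mulrA sin_div_lipschitz.
Qed.

(* The tangent line to [s |-> cos (sqrt s)] at [b ^+ 2] has slope
   [- sinc b / 2] and lies below the graph, with a quadratic error. *)
Lemma cos_sqr_tangent a b : 0 <= a <= pi -> 0 <= b <= pi ->
  0 <= cos a - cos b - sinc b / 2 * (b ^+ 2 - a ^+ 2)
    <= (b ^+ 2 - a ^+ 2) ^+ 2 / 12.
Proof.
move=> /andP[a0 api] /andP[b0 bpi].
(* By Cauchy's mean value theorem the slope is [sinc c / 2] for some [c] in between, and [sinc] is
   nonincreasing. *)
have slope x y : 0 <= x -> x < y -> y <= pi ->
    sinc y / 2 * (y ^+ 2 - x ^+ 2) <= cos x - cos y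
      <= sinc x / 2 * (y ^+ 2 - x ^+ 2).
  move=> x0 xy ypi; have [c /andP[xc cy]] := cos_sqr_slope x0 xy.
  have c0 : 0 < c by rewrite (le_lt_trans x0).
  rewrite -(mul_sinc c) => cE.
  have -> : cos x - cos y = sinc c / 2 * (y ^+ 2 - x ^+ 2).
    have c20 : 2 * c != 0 by rewrite mulf_neq0// ?gt_eqF.
    by apply: (mulfI c20); rewrite cE; field.
  have xy2 : 0 <= y ^+ 2 - x ^+ 2.
    by rewrite subr_ge0 ler_sqr ?nnegrE ?(ltW xy)// (le_trans x0)// ltW.
  rewrite !ler_wpM2r// sinc_antitone//; try exact: ltW.
  by rewrite (le_trans (ltW cy)).
have [ab|ba|<-] := ltgtP a b; last by rewrite !subrr; lra.
- have /andP[lo hi] := slope _ _ a0 ab bpi.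
  have L := sinc_lipschitz a0 (ltW ab).
  have ab2 : 0 <= b ^+ 2 - a ^+ 2 by rewrite subr_ge0 ler_sqr ?nnegrE// ltW.
  by have := ler_wpM2r ab2 L; lra.
- have /andP[lo hi] := slope _ _ b0 ba api.
  have L := sinc_lipschitz b0 (ltW ba).
  have ab2 : 0 <= a ^+ 2 - b ^+ 2 by rewrite subr_ge0 ler_sqr ?nnegrE// ltW.
  by have := ler_wpM2r ab2 L; lra.
Qed.

End Trig.

(** * Sine weights against affine weights, and cosines against squared distances *)

Section Comparison.
Context {R : realType}.
Implicit Types (a b u C D K : R).

(** With half angles [x] and [y] the left side is [4 sin x sin y sin (x + y)]. Then
    [sin x sin y <= x y], and [sin (x + y)] is [sin (a + b)] over [2 cos (x + y)], where
    [cos (x + y) >= cos D]. *)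
Lemma sinD_defect a b D : 0 <= a -> 0 <= b -> a + b <= 2 * D -> D < pi / 2 ->
  sin a + sin b - sin (a + b) <= a * b * sin (a + b) / (2 * cos D).
Proof.
move=> a0 b0 abD Dpi; have pi0 := @pi_gt0 R.
have cD : 0 < cos D by apply: cos_gt0_pihalf; lra.
pose x := a / 2; pose y := b / 2.
have [x0 y0] : 0 <= x /\ 0 <= y by rewrite /x /y; split; lra.
have xyD : x + y <= D by rewrite /x /y; lra.
have -> : a = x *+ 2 by rewrite /x; lra.
have -> : b = y *+ 2 by rewrite /y; lra.
rewrite -mulrnDl !sin_mulr2n.
have -> : (cos x * sin x) *+ 2 + (cos y * sin y) *+ 2
    - (cos (x + y) * sin (x + y)) *+ 2 = 4 * (sin x * sin y) * sin (x + y).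
  rewrite sinD cosD; have := cos2Dsin2 x; have := cos2Dsin2 y.
  set cx := cos x; set sx := sin x; set cy := cos y; set sy := sin y => hy hx.
  have h1 : sx ^+ 2 = 1 - cx ^+ 2 by lra.
  have h2 : sy ^+ 2 = 1 - cy ^+ 2 by lra.
  by ring: h1 h2.
have sxy : 0 <= sin (x + y) by apply: sin_ge0_pi; lra.
have -> : (x *+ 2) * (y *+ 2) * ((cos (x + y) * sin (x + y)) *+ 2) / (2 * cos D)
    = 4 * (x * y) * sin (x + y) * (cos (x + y) / cos D).
  by field; rewrite gt_eqF.
have cxy : 1 <= cos (x + y) / cos D.
  rewrite ler_pdivlMr// mul1r leNgt ltr_cos ?in_itv/= -?leNgt//; lra.
have s_ge0 z : 0 <= z -> z <= D -> 0 <= sin z.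
  by move=> *; apply: sin_ge0_pi; lra.
have xyxy : sin x * sin y <= x * y.
  by rewrite ler_pM ?sin_le// s_ge0//; lra.
rewrite -[leLHS]mulr1 ler_pM//.
- by rewrite !mulr_ge0// s_ge0//; lra.
- by rewrite ler_wpM2r// ler_wpM2l.
Qed.

(* The weights [sin b / sin (a + b)] and [sin a / sin (a + b)] of a point on a
   segment of the plane seen from the origin exceed the affine weights
   [b / (a + b)] and [a / (a + b)], by O(a b) in total. *)
Lemma sin_weights_error a b D u0 u1 : 0 < a -> 0 < b -> a + b <= 2 * D ->
    D < pi / 2 -> `|u0| <= 1 -> `|u1| <= 1 ->
  `|sin b * u0 + sin a * u1 - sin (a + b) * ((b * u0 + a * u1) / (a + b))|
     <= a * b * sin (a + b) / (2 * cos D).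
Proof.
move=> a0 b0 abD Dpi u01 u11.
have ab0 : 0 < a + b by rewrite addr_gt0.
pose x0 := sin b - sin (a + b) * (b / (a + b)).
pose x1 := sin a - sin (a + b) * (a / (a + b)).
(* Both excesses [x0] and [x1] are nonnegative because [sin z / z] is nonincreasing, so the error is
   at most their sum, which is the defect in [sinD_defect]. *)
have w0 z : 0 <= z -> z <= a + b -> 0 <= sin z - sin (a + b) * (z / (a + b)).
  move=> z0 zab; rewrite subr_ge0 mulrA ler_pdivrMr// mulrC [leRHS]mulrC.
  by rewrite sin_div_antitone//; lra.
have -> : sin b * u0 + sin a * u1 - sin (a + b) * ((b * u0 + a * u1) / (a + b))
   = x0 * u0 + x1 * u1 by rewrite /x0 /x1; field; rewrite gt_eqF.
have x00 : 0 <= x0 by apply: w0; lra.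
have x10 : 0 <= x1 by apply: w0; lra.
apply: le_trans (ler_normD _ _) _.
rewrite !normrM (ger0_norm x00) (ger0_norm x10).
apply: (@le_trans _ _ (x0 + x1)); first by rewrite lerD// ler_piMr.
have -> : x0 + x1 = sin a + sin b - sin (a + b).
  by rewrite /x0 /x1; field; rewrite gt_eqF.
by rewrite sinD_defect// ltW.
Qed.

(** Truncation at [pi] preserves tangents from below in the variable [d ^+ 2]: past [pi] the cosine
    has reached its minimum and slope 0 works; before [pi] the slope is that of
    [cos_sqr_tangent]. *)
Lemma cos_min_pi_tangent b : 0 <= b -> exists2 k, 0 <= k <= 1 &
  forall a, 0 <= a ->
    cos (Num.min pi b) - k / 2 * (a ^+ 2 - b ^+ 2) <= cos (Num.min pi a).
Proof.
move=> b0; have pi0 := @pi_ge0 R.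
have [bpi|bpi] := leP pi b.
  exists 0; first by rewrite lexx ler01.
  by move=> a _; rewrite !mul0r subr0 cospi cos_geN1.
exists (sinc b); first by rewrite sinc_le1// ltW// sinc_gt0// b0.
have tangent a : 0 <= a <= pi ->
    cos b - sinc b / 2 * (a ^+ 2 - b ^+ 2) <= cos a.
  move=> a0pi; have /(_ b) := cos_sqr_tangent a0pi.
  by rewrite b0 ltW// => /(_ isT)/andP[+ _]; lra.
move=> a a0; have [pia|api] := leP pi a; last first.
  by apply: tangent; rewrite a0 ltW.
(* The tangent line is nonincreasing in [a], so beyond [pi] it stays below its value at [pi]. *)
apply: le_trans (tangent pi _); last by rewrite pi0 lexx.
rewrite lerD2l lerN2 ler_wpM2l//.
  by rewrite divr_ge0// ltW// sinc_gt0// b0.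
by rewrite lerD2r ler_sqr.
Qed.

(** The tangent at [d] is evaluated at [d0] and [d1] with weights [b] and [a]; its slope lies in
    [[-1/2, 0]], whence the constant [|K| / 2]. *)
Lemma sqr_semiconcave_cos K a b d0 d d1 : 0 < a -> 0 < b ->
    0 <= d0 -> 0 <= d -> 0 <= d1 ->
    b * d0 ^+ 2 + a * d1 ^+ 2 <= (a + b) * d ^+ 2 + K * (a * b * (a + b)) ->
  (a + b) * cos (Num.min pi d) <= b * cos (Num.min pi d0)
    + a * cos (Num.min pi d1) + `|K| / 2 * (a * b * (a + b)).
Proof.
move=> a0 b0 d00 dge0 d10 H.
have [k /andP[k0 k1] tg] := cos_min_pi_tangent dge0.
have /(ler_wpM2l (ltW b0)) t0 := tg _ d00.
have /(ler_wpM2l (ltW a0)) t1 := tg _ d10.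
have P0 : 0 <= a * b * (a + b) by rewrite !mulr_ge0 ?addr_ge0 ?ltW.
set P := a * b * (a + b) in H P0 *.
have : k / 2 * (b * d0 ^+ 2 + a * d1 ^+ 2 - (a + b) * d ^+ 2) <= `|K| / 2 * P.
  apply: (@le_trans _ _ (k / 2 * (`|K| * P))).
    apply: ler_wpM2l; first by rewrite divr_ge0.
    by have := ler_wpM2r P0 (ler_norm K); lra.
  by have := ler_wpM2r (mulr_ge0 (normr_ge0 K) P0) k1; lra.
lra.
Qed.

(** The tangent at [d] now bounds [cos] from above up to a quadratic error. The Lipschitz hypotheses
    turn the errors into multiples of [b * a ^+ 2 + a * b ^+ 2 = a * b * (a + b)]. *)
Lemma cos_semiconvex_sqr C D a b d0 d d1 : 0 < a -> 0 < b ->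
    D < pi / 2 -> 0 <= C ->
    0 <= d0 <= 2 * D -> 0 <= d <= 2 * D -> 0 <= d1 <= 2 * D ->
    `|d0 - d| <= a -> `|d1 - d| <= b ->
    (a + b) * cos d <= b * cos d0 + a * cos d1 + C * (a * b * (a + b)) ->
  b * d0 ^+ 2 + a * d1 ^+ 2 <= (a + b) * d ^+ 2
    + (C + 4 / 3 * D ^+ 2) * (2 / sinc (2 * D)) * (a * b * (a + b)).
Proof.
move=> a0 b0 Dpi C0 d0D dD d1D d0a d1b H.
have pi0 := @pi_gt0 R.
have bound e c : 0 <= c -> 0 <= e <= 2 * D -> `|e - d| <= c ->
    cos e <= cos d - sinc d / 2 * (e ^+ 2 - d ^+ 2) + 4 / 3 * D ^+ 2 * c ^+ 2.
  move=> c0 /andP[e0 eD] edc; case/andP: dD => dd0 dD.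
  have := @cos_sqr_tangent R e d; rewrite e0 dd0 => /(_ _ _)/andP[||_].
  - lra.
  - lra.
  (* Since [d + e <= 4 * D], the error [1 / 12] of the tangent becomes [16 / 12 = 4 / 3]. *)
  have : (d ^+ 2 - e ^+ 2) ^+ 2 <= c ^+ 2 * (4 * D) ^+ 2.
    have -> : (d ^+ 2 - e ^+ 2) ^+ 2 = (e - d) ^+ 2 * (d + e) ^+ 2 by ring.
    apply: ler_pM; rewrite ?sqr_ge0//.
      by rewrite -[leLHS]real_normK ?num_real// ler_sqr ?nnegrE.
    by rewrite ler_sqr ?nnegrE; lra.
  lra.
have /(ler_wpM2l (ltW b0)) t0 := bound _ _ (ltW a0) d0D d0a.
have /(ler_wpM2l (ltW a0)) t1 := bound _ _ (ltW b0) d1D d1b.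
have P0 : 0 <= a * b * (a + b) by rewrite !mulr_ge0 ?addr_ge0 ?ltW.
have D0 : 0 <= 2 * D by case/andP: dD => /le_trans; apply.
have s0 : 0 < sinc (2 * D) by apply: sinc_gt0; lra.
have sd : sinc (2 * D) <= sinc d.
  by case/andP: dD => *; apply: sinc_antitone => //; lra.
set X := b * d0 ^+ 2 + a * d1 ^+ 2 - (a + b) * d ^+ 2.
have {t0 t1} : sinc d / 2 * X <= (C + 4 / 3 * D ^+ 2) * (a * b * (a + b)).
  by rewrite /X; lra.
move=> XP; rewrite -lerBlDl -/X.
(* For [X <= 0] the bound is trivial; otherwise [sinc d] may be lowered to [sinc (2 * D)]. *)
have [X0|/ltW X0] := leP X 0.
  apply: le_trans X0 _; rewrite mulr_ge0// mulr_ge0//.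
    by rewrite addr_ge0// mulr_ge0 ?sqr_ge0// divr_ge0.
  by rewrite divr_ge0// ltW.
have {}XP : sinc (2 * D) / 2 * X <= (C + 4 / 3 * D ^+ 2) * (a * b * (a + b)).
  apply: le_trans XP; rewrite ler_wpM2r// ler_pM2r ?invr_gt0//.
rewrite mulrAC mulrA ler_pdivlMr// (mulrC X); lra.
Qed.

End Comparison.

(** * Three-point semiconcavity and planar segments *)

Section Semiconcave.
Context {R : realType}.
Implicit Types (K s t : R) (f : R -> R).

(** The chord of [t ^+ 2] exceeds its graph by [l * (1 - l) * (s1 - s0) ^+ 2]. *)
Let convexE K f : semiconcave K f <-> forall l, 0 <= l <= 1 ->
  forall s0 s1, 0 <= s0 <= 1 -> 0 <= s1 <= 1 ->
    l * f s0 + (1 - l) * f s1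
      <= f (l * s0 + (1 - l) * s1) + K * (l * (1 - l) * (s1 - s0) ^+ 2).
Proof.
split=> [cf l /andP[l0 l1] s0 s1 s00 s10|H l s0 s1].
  have : - (f (l * s0 + (1 - l) * s1) - K * (l * s0 + (1 - l) * s1) ^+ 2) <=
      l * - (f s0 - K * s0 ^+ 2) + (1 - l) * - (f s1 - K * s1 ^+ 2).
    by apply: (cf (Itv01 l0 l1) s0 s1); rewrite inE/= in_itv.
  lra.
rewrite !inE/= !in_itv/= => s00 s10.
have /H/(_ s0 s1 s00 s10) : 0 <= l%:num <= 1 by rewrite ge0 le1.
set k : R := l%:num => Hk.
suff : - (f (k * s0 + (1 - k) * s1) - K * (k * s0 + (1 - k) * s1) ^+ 2) <=
    k * - (f s0 - K * s0 ^+ 2) + (1 - k) * - (f s1 - K * s1 ^+ 2) by [].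
lra.
Qed.

(** Division-free form for three ordered points; its gaps are matched later with gaps between
    angles. *)
Lemma semiconcaveP K f : semiconcave K f <->
  forall s0 s s1, 0 <= s0 -> s0 < s -> s < s1 -> s1 <= 1 ->
    (s1 - s) * f s0 + (s - s0) * f s1
      <= (s1 - s0) * f s + K * ((s1 - s) * (s - s0) * (s1 - s0)).
Proof.
split=> [/convexE H s0 s s1 s00 s0s ss1 s11|H]; last first.
  apply/convexE => l /andP[l0 l1] s0 s1.
  wlog s01 : l l0 l1 s0 s1 / s0 <= s1 => [W s0I s1I|].
    have [?|/ltW s10] := leP s0 s1; first exact: W.
    have := W (1 - l) _ _ _ _ s10 s1I s0I.
    have -> : 1 - (1 - l) = l by ring.
    rewrite subr_ge0 lerBlDr lerDl => /(_ l1 l0).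
    by rewrite (addrC (_ * s1)) (addrC (_ * f s1)); lra.
  move=> /andP[s00 _] /andP[_ s11].
  move: s01; rewrite le_eqVlt => /predU1P[<-|s01].
    have -> : l * s0 + (1 - l) * s0 = s0 by ring.
    lra.
  move: l0; rewrite le_eqVlt => /predU1P[<-|l0].
    have -> : 0 * s0 + (1 - 0) * s1 = s1 by ring.
    lra.
  move: l1; rewrite le_eqVlt => /predU1P[->|l1].
    have -> : 1 * s0 + (1 - 1) * s1 = s0 by ring.
    lra.
  have d0 : 0 < s1 - s0 by rewrite subr_gt0.
  have e0 := mulr_gt0 l0 d0.
  have e1 : 0 < (1 - l) * (s1 - s0) by rewrite mulr_gt0// subr_gt0.
  have := H s0 (l * s0 + (1 - l) * s1) s1 s00 _ _ s11.
  set s := l * s0 + _ => /(_ _ _)/wrap[||]; [rewrite /s; lra|rewrite /s; lra|].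
  have -> : s1 - s = l * (s1 - s0) by rewrite /s; ring.
  have -> : s - s0 = (1 - l) * (s1 - s0) by rewrite /s; ring.
  move=> h; rewrite -(ler_pM2l d0); lra.
have s01 : 0 < s1 - s0 by lra.
pose l := (s1 - s) / (s1 - s0).
have l01 : 0 <= l <= 1.
  by rewrite divr_ge0 ?ler_pdivrMr// ?mul1r; lra.
have := H l l01 s0 s1.
have -> : l * s0 + (1 - l) * s1 = s by rewrite /l; field; rewrite gt_eqF.
move=> /(_ _ _)/wrap[||/(ler_wpM2l (ltW s01))]; [lra|lra|].
have -> : (s1 - s0) * (l * f s0 + (1 - l) * f s1)
  = (s1 - s) * f s0 + (s - s0) * f s1 by rewrite /l; field; rewrite gt_eqF.
have -> : (s1 - s0) * (f s + K * (l * (1 - l) * (s1 - s0) ^+ 2))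
  = (s1 - s0) * f s + K * ((s1 - s) * (s - s0) * (s1 - s0)).
  by rewrite /l; field; rewrite gt_eqF.
by [].
Qed.

End Semiconcave.

(** * A segment of the plane in polar coordinates *)

Section PlanarSegment.
Context {R : realType}.
Implicit Types (r phi D t : R).

(** [seg_norm] and [seg_angle] are the polar coordinates of the point dividing, at parameter [t],
    the segment from the point of radius [r0] and angle 0 to that of radius [r1] and angle [phi]. *)
Definition seg_norm r0 r1 phi t : R :=
  Num.sqrt ((1 - t) ^+ 2 * r0 ^+ 2 + t ^+ 2 * r1 ^+ 2
    + 2 * t * (1 - t) * r0 * r1 * cos phi).

Definition seg_angle r0 r1 phi t : R :=
  acos (((1 - t) * r0 + t * r1 * cos phi) / seg_norm r0 r1 phi t).

Lemma sqr_seg_norm r0 r1 phi t : 0 <= r0 -> 0 <= r1 -> 0 <= t <= 1 ->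
  seg_norm r0 r1 phi t ^+ 2 = (1 - t) ^+ 2 * r0 ^+ 2 + t ^+ 2 * r1 ^+ 2
    + 2 * t * (1 - t) * r0 * r1 * cos phi.
Proof.
move=> r00 r10 /andP[t0 t1]; rewrite sqr_sqrtr//.
have t1' : 0 <= 1 - t by rewrite subr_ge0.
(* The shift by [pi] flips the sign of the cosine term. *)
have := cone_radicand_ge0 (phi + pi) (mulr_ge0 t1' r00) (mulr_ge0 t0 r10).
by rewrite cosDpi; lra.
Qed.

(** With [a = (1 - t) * r0], [b = t * r1] and [c = cos D], the bound [cos phi >= 2 * c ^+ 2 - 1]
    makes the squared norm at least [c ^+ 2 * (a + b) ^+ 2 + (1 - c ^+ 2) * (a - b) ^+ 2]. *)
Lemma seg_norm_ge r0 r1 phi D t : 0 <= r0 -> 0 <= r1 -> 0 <= t <= 1 ->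
    0 <= phi <= 2 * D -> D < pi / 2 ->
  cos D * ((1 - t) * r0 + t * r1) <= seg_norm r0 r1 phi t.
Proof.
move=> r00 r10 t01 /andP[phi0 phiD] Dpi; have pi0 := @pi_gt0 R.
have cD : 0 < cos D by apply: cos_gt0_pihalf; lra.
have /andP[t0 t1] := t01.
have a0 : 0 <= (1 - t) * r0 by rewrite mulr_ge0// subr_ge0.
have b0 : 0 <= t * r1 by rewrite mulr_ge0.
rewrite -ler_sqr ?nnegrE ?sqrtr_ge0 ?mulr_ge0 ?addr_ge0 ?(ltW cD)//.
rewrite sqr_seg_norm//.
have : cos (2 * D) <= cos phi.
  by rewrite leNgt ltr_cos ?in_itv/= -?leNgt//; lra.
have -> : 2 * D = D *+ 2 by lra.
rewrite cos_mulr2n.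
have := cos_le1 D; have := sqr_ge0 ((1 - t) * r0 - t * r1).
have := mulr_ge0 a0 b0.
set a := (1 - t) * r0 in a0 *; set b := t * r1 in b0 *.
have -> : (1 - t) ^+ 2 * r0 ^+ 2 + t ^+ 2 * r1 ^+ 2
    + 2 * t * (1 - t) * r0 * r1 * cos phi
  = a ^+ 2 + b ^+ 2 + 2 * (a * b) * cos phi by rewrite /a /b; ring.
set c := cos D in cD *; set e := cos phi => ab0 sq c1 ce.
have h1 : 0 <= (a - b) ^+ 2 * (1 - c ^+ 2).
  by rewrite mulr_ge0 ?sqr_ge0// subr_ge0 expr_le1// ltW.
have h2 := ler_wpM2l ab0 ce.
lra.
Qed.

Section Polar.
Variables (r0 r1 phi : R).
Hypotheses (r0_gt0 : 0 < r0) (r1_gt0 : 0 < r1) (phi_pi : 0 < phi < pi).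
Let r t := seg_norm r0 r1 phi t.
Let th t := seg_angle r0 r1 phi t.

Lemma seg_norm_gt0 t : 0 <= t <= 1 -> 0 < r t.
Proof.
move=> t01; rewrite lt0r sqrtr_ge0 andbT -sqrf_eq0.
rewrite sqr_seg_norm ?(ltW r0_gt0) ?(ltW r1_gt0)//.
have -> : (1 - t) ^+ 2 * r0 ^+ 2 + t ^+ 2 * r1 ^+ 2
    + 2 * t * (1 - t) * r0 * r1 * cos phi
  = ((1 - t) * r0 + t * r1 * cos phi) ^+ 2 + (t * r1 * sin phi) ^+ 2.
  by have := sin2cos2 phi => h; ring: h.
rewrite paddr_eq0 ?sqr_ge0// !sqrf_eq0 !mulf_eq0 (gt_eqF r1_gt0).
rewrite (gt_eqF (sin_gt0_pi phi_pi)) !orbF.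
apply/negP => /andP[+ /eqP t0]; rewrite t0 !mul0r addr0 subr0 mul1r.
by rewrite gt_eqF.
Qed.

Let ratio_bound t : 0 <= t <= 1 ->
  -1 <= ((1 - t) * r0 + t * r1 * cos phi) / r t <= 1.
Proof.
move=> t01; have rt := seg_norm_gt0 t01.
rewrite ler_pdivrMr// ler_pdivlMr// mul1r mulN1r -ler_norml.
rewrite -ler_sqr ?nnegrE ?normr_ge0 ?(ltW rt)// real_normK ?num_real//.
rewrite sqr_seg_norm ?(ltW r0_gt0) ?(ltW r1_gt0)//.
have h := sin2cos2 phi; rewrite -subr_ge0.
suff -> : (1 - t) ^+ 2 * r0 ^+ 2 + t ^+ 2 * r1 ^+ 2
    + 2 * t * (1 - t) * r0 * r1 * cos phi
    - ((1 - t) * r0 + t * r1 * cos phi) ^+ 2 = (t * r1 * sin phi) ^+ 2.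
  exact: sqr_ge0.
by ring: h.
Qed.

Lemma seg_cos t : 0 <= t <= 1 ->
  r t * cos (th t) = (1 - t) * r0 + t * r1 * cos phi.
Proof.
move=> t01; rewrite /th /seg_angle acosK; last exact: ratio_bound.
by rewrite mulrC divfK// gt_eqF// seg_norm_gt0.
Qed.

(** The cosine determines the sine up to sign, and both sides are nonnegative. *)
Lemma seg_sin t : 0 <= t <= 1 -> r t * sin (th t) = t * r1 * sin phi.
Proof.
move=> t01; have rt := seg_norm_gt0 t01; have /andP[t0 t1] := t01.
have s0 := sin_gt0_pi phi_pi.
have x0 : 0 <= sin (th t).
  by apply: sin_ge0_pi; rewrite acos_ge0 ?acos_lepi// ratio_bound.
have y0 : 0 <= r t * sin (th t) by rewrite mulr_ge0// ltW.
apply/eqP; rewrite -(@eqrXn2 _ 2)//; last by rewrite !mulr_ge0// ltW.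
apply/eqP.
have -> : (r t * sin (th t)) ^+ 2 = r t ^+ 2 - (r t * cos (th t)) ^+ 2.
  by have h := sin2cos2 (th t); ring: h.
rewrite seg_cos// sqr_seg_norm ?(ltW r0_gt0) ?(ltW r1_gt0)//.
by have h := sin2cos2 phi; ring: h.
Qed.

Lemma seg_angle_bound t : 0 <= t <= 1 -> 0 <= th t <= phi.
Proof.
move=> t01; have rt := seg_norm_gt0 t01; have /andP[t0 t1] := t01.
have /andP[phi0 phipi] := phi_pi; have s0 := sin_gt0_pi phi_pi.
have th0 : 0 <= th t by rewrite acos_ge0// ratio_bound.
have thpi : th t <= pi by rewrite acos_lepi// ratio_bound.
rewrite th0 leNgt; apply/negP => phith.
(* This quantity also equals [- (1 - t) * r0 * sin phi], which is not positive. *)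
have : 0 < r t * sin (th t - phi).
  by rewrite mulr_gt0// sin_gt0_pi//; lra.
have -> : r t * sin (th t - phi)
    = (r t * sin (th t)) * cos phi - (r t * cos (th t)) * sin phi.
  by rewrite sinB; ring.
rewrite seg_sin// seg_cos//.
have : 0 <= (1 - t) * r0 * sin phi.
  by rewrite !mulr_ge0 ?subr_ge0// ltW.
lra.
Qed.

(** Both sides are the cross product of two points of the segment; this converts sines of angle gaps
    into parameter gaps. *)
Lemma seg_cross t0 t1 : 0 <= t0 <= 1 -> 0 <= t1 <= 1 ->
  r t0 * r t1 * sin (th t1 - th t0) = (t1 - t0) * (r0 * r1 * sin phi).
Proof.
move=> t0I t1I; transitivity ((r t0 * cos (th t0)) * (r t1 * sin (th t1))
    - (r t0 * sin (th t0)) * (r t1 * cos (th t1))).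
  by rewrite sinB; ring.
by rewrite !seg_sin// !seg_cos//; ring.
Qed.

Lemma seg_angle_lt t0 t1 : 0 <= t0 -> t0 < t1 -> t1 <= 1 -> th t0 < th t1.
Proof.
move=> t00 t01 t11.
have t0I : 0 <= t0 <= 1 by lra.
have t1I : 0 <= t1 <= 1 by lra.
have /andP[a0 aphi] := seg_angle_bound t0I.
have /andP[b0 bphi] := seg_angle_bound t1I.
have /andP[phi0 phipi] := phi_pi.
rewrite ltNge; apply/negP => ba.
have : r t0 * r t1 * sin (th t1 - th t0) <= 0.
  rewrite -opprB sinN mulrN oppr_le0 !mulr_ge0 ?sqrtr_ge0//.
  by apply: sin_ge0_pi; lra.
rewrite seg_cross// leNgt => /negP; apply.
by rewrite !mulr_gt0 ?subr_gt0// sin_gt0_pi.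
Qed.

(* The distance from the origin to the line through the segment is
   [r0 * r1 * sin phi] over the length of the segment. *)
Lemma seg_norm_ge_height d t : 0 <= d ->
    d ^+ 2 = r0 ^+ 2 + r1 ^+ 2 - 2 * r0 * r1 * cos phi -> 0 <= t <= 1 ->
  r0 * r1 * sin phi <= d * r t.
Proof.
move=> d0 dE t01; have s0 := sin_gt0_pi phi_pi.
have r00 := ltW r0_gt0; have r10 := ltW r1_gt0.
rewrite -ler_sqr ?nnegrE; last 2 first.
- by rewrite !mulr_ge0// ltW.
- by rewrite mulr_ge0// sqrtr_ge0.
rewrite [leRHS]exprMn dE sqr_seg_norm ?(ltW r0_gt0) ?(ltW r1_gt0)// -subr_ge0.
set q := r0 ^+ 2 + r1 ^+ 2 - _.
(* Lagrange's identity: the square on the right is that of the inner product of the point with the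
   direction of the segment. *)
suff -> : q * ((1 - t) ^+ 2 * r0 ^+ 2 + t ^+ 2 * r1 ^+ 2
    + 2 * t * (1 - t) * r0 * r1 * cos phi) - (r0 * r1 * sin phi) ^+ 2
  = (r0 * (r1 * cos phi - r0) + t * q) ^+ 2 by exact: sqr_ge0.
by have h := sin2cos2 phi; rewrite /q; ring: h.
Qed.

End Polar.

(* Inverse of [seg_angle] for an isosceles segment. *)
Lemma seg_isosceles r phi th : 0 < r -> 0 < phi < pi -> 0 <= th <= phi ->
  let t := sin th / (sin th + sin (phi - th)) in
  0 <= t <= 1 /\ seg_angle r r phi t = th.
Proof.
move=> r0 phi_pi /andP[th0 thphi] t; have /andP[phi0 phipi] := phi_pi.
have s0 := sin_gt0_pi phi_pi.
have a0 : 0 <= sin th by apply: sin_ge0_pi; lra.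
have b0 : 0 <= sin (phi - th) by apply: sin_ge0_pi; lra.
have phiE : sin phi = sin th * cos (phi - th) + cos th * sin (phi - th).
  by rewrite -sinD; congr sin; ring.
have ab0 : 0 < sin th + sin (phi - th).
  rewrite lt0r addr_ge0// andbT paddr_eq0//; apply/negP => /andP[/eqP a /eqP b].
  by move: s0; rewrite phiE a b mul0r mulr0 addr0 ltxx.
have abn : sin th + sin (phi - th) != 0 by rewrite gt_eqF.
have t01 : 0 <= t <= 1.
  by rewrite divr_ge0 ?ler_pdivrMr ?mul1r ?lerDl// ltW.
split=> //.
(* By the addition formulas the numerator of the squared norm collapses to [sin phi ^+ 2]. *)
have nE : seg_norm r r phi t = r * sin phi / (sin th + sin (phi - th)).
  apply/eqP; rewrite -(@eqrXn2 _ 2) ?sqrtr_ge0//; last first.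
    by rewrite divr_ge0 ?mulr_ge0// ltW.
  rewrite sqr_seg_norm ?(ltW r0)//.
  have -> : (1 - t) ^+ 2 * r ^+ 2 + t ^+ 2 * r ^+ 2
      + 2 * t * (1 - t) * r * r * cos phi
    = (r / (sin th + sin (phi - th))) ^+ 2 * (sin (phi - th) ^+ 2
      + sin th ^+ 2 + 2 * sin th * sin (phi - th) * cos phi).
    by rewrite /t; field.
  have -> : sin (phi - th) ^+ 2 + sin th ^+ 2
      + 2 * sin th * sin (phi - th) * cos phi = sin phi ^+ 2.
    have -> : cos phi = cos th * cos (phi - th) - sin th * sin (phi - th).
      by rewrite -cosD; congr cos; ring.
    rewrite phiE; have h := sin2cos2 th; have h' := sin2cos2 (phi - th).
    by ring: h h'.
  by apply/eqP; field.
rewrite /seg_angle nE -[RHS]cosK ?in_itv/= ?th0 ?(le_trans thphi) ?ltW//.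
congr acos.
have -> : (1 - t) * r + t * r * cos phi = r / (sin th + sin (phi - th))
    * (sin (phi - th) + sin th * cos phi) by rewrite /t; field.
have -> : sin (phi - th) + sin th * cos phi = sin phi * cos th.
  by rewrite sinB; ring.
by field; rewrite abn (gt_eqF s0) gt_eqF.
Qed.

End PlanarSegment.

(** * Transfer between the cone and its base *)

Section ConeEstimates.
Context {R : realType}.
Implicit Types (q r phi D K t u : R) (d : R -> R).

(* [2 D / sin (2 D)] bounds [a / sin a] for [a <= 2 D], and
   [(r0^-1 + r1^-1) / cos D] bounds the inverse of the norm on the segment.  The
   latter degenerates to a smaller value when [r0] or [r1] vanishes, but there
   any constant [>= 1] will do. *)
Definition cone_const (K r0 r1 r2 D : R) : R :=
  1 + r2 * (`|K| + (cos D)^-1) * (2 * D / sin (2 * D)) ^+ 2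
      * ((r0^-1 + r1^-1) / cos D).

(** The first summand comes from the cone hypothesis, [(2 * cos D)^-1] from the sine weights,
    [4 / 3 * D ^+ 2] from the second-order error of the cosine; the last factor is
    [2 / sinc (2 * D)]. *)
Definition base_const (K r0 r2 D : R) : R :=
  (`|K - 1| / (2 * r2) * (r0 / cos D ^+ 2) + (2 * cos D)^-1 + 4 / 3 * D ^+ 2)
  * (2 / (sin (2 * D) / (2 * D))).

(** Here [d] stands for the distance to [x2] along [x01], so that the estimates involve real
    functions only. *)
Definition cone_sqr_dist r0 r1 r2 phi d t :=
  r2 ^+ 2 + seg_norm r0 r1 phi t ^+ 2 - 2 * r2 * seg_norm r0 r1 phi t
    * cos (Num.min pi (d (phi^-1 * seg_angle r0 r1 phi t))).

Lemma cone_const_ge1 K r0 r1 r2 D : 0 <= r0 -> 0 <= r1 -> 0 <= r2 ->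
  0 < D < pi / 2 -> 1 <= cone_const K r0 r1 r2 D.
Proof.
move=> r00 r10 r20 /andP[D0 Dpi]; rewrite lerDl.
have cD : 0 < cos D by apply: cos_gt0_pihalf; lra.
have W : 0 <= r0^-1 + r1^-1 by rewrite addr_ge0 ?invr_ge0.
have cV : 0 <= (cos D)^-1 by rewrite invr_ge0 ltW.
apply: mulr_ge0; last by rewrite divr_ge0// ltW.
by rewrite mulr_ge0 ?sqr_ge0// mulr_ge0// addr_ge0.
Qed.

Lemma seg_weights_le a b D : 0 <= a -> 0 <= b -> a + b <= 2 * D ->
  0 < D < pi / 2 ->
  a * b <= (2 * D / sin (2 * D)) ^+ 2 * (sin a * sin b).
Proof.
move=> a0 b0 abD /andP[D0 Dpi].
have sD : 0 < sin (2 * D) by apply: sin_gt0_pi; lra.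
have le z : 0 <= z -> z <= 2 * D -> z <= 2 * D / sin (2 * D) * sin z.
  move=> z0 zD; rewrite mulrAC ler_pdivlMr//.
  by apply: sin_div_antitone => //; lra.
rewrite expr2 mulrACA ler_pM// le//; lra.
Qed.

(** Stewart's theorem for a cevian from the origin, where [q] is the length of the segment. *)
Lemma seg_norm_stewart r0 r1 phi q t0 t t1 :
    0 <= r0 -> 0 <= r1 ->
    q ^+ 2 = r0 ^+ 2 + r1 ^+ 2 - 2 * r0 * r1 * cos phi ->
    0 <= t0 <= 1 -> 0 <= t <= 1 -> 0 <= t1 <= 1 ->
  let n := seg_norm r0 r1 phi in
  (t1 - t) * n t0 ^+ 2 + (t - t0) * n t1 ^+ 2
    = (t1 - t0) * n t ^+ 2 + q ^+ 2 * ((t1 - t) * (t - t0) * (t1 - t0)).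
Proof. by move=> r00 r10 qE *; rewrite /= !sqr_seg_norm// qE; ring. Qed.

Lemma seg_triple r0 r1 phi t0 t t1 :
    0 < r0 -> 0 < r1 -> 0 < phi < pi ->
    0 <= t0 -> t0 < t -> t < t1 -> t1 <= 1 ->
  let n := seg_norm r0 r1 phi in
  let a := seg_angle r0 r1 phi t - seg_angle r0 r1 phi t0 in
  let b := seg_angle r0 r1 phi t1 - seg_angle r0 r1 phi t in
  let A := r0 * r1 * sin phi in
  [/\ [/\ 0 < a, 0 < b & a + b <= phi],
      n t0 * n t1 * sin (a + b) = (t1 - t0) * A,
      n t0 * n t * sin a = (t - t0) * A &
      n t * n t1 * sin b = (t1 - t) * A].
Proof.
move=> r00 r10 phi_pi t00 t0t tt1 t11 n a b A.
have t0I : 0 <= t0 <= 1 by lra.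
have tI : 0 <= t <= 1 by lra.
have t1I : 0 <= t1 <= 1 by lra.
have -> : a + b = seg_angle r0 r1 phi t1 - seg_angle r0 r1 phi t0.
  by rewrite /a /b; ring.
have /andP[x0 _] := seg_angle_bound r00 r10 phi_pi t0I.
have /andP[_ x1] := seg_angle_bound r00 r10 phi_pi t1I.
split; [|exact: seg_cross..]; split.
- by rewrite subr_gt0; apply: seg_angle_lt => //; case/andP: tI.
- by rewrite subr_gt0; apply: seg_angle_lt => //; case/andP: tI.
- lra.
Qed.

Section SegmentWeights.
(** At three successive points of a segment: norms [n0], [n], [n1], parameter gaps [p0], [p1], angle
    gaps [a], [b]. [A] is twice the area of the triangle spanned with the origin by the whole
    segment, and [q] stands for its length. *)
Variables n0 n n1 A p0 p1 a b u0 u u1 q D : R.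
Hypotheses (n0_gt0 : 0 < n0) (n_gt0 : 0 < n) (n1_gt0 : 0 < n1) (A_gt0 : 0 < A)
  (p0_gt0 : 0 < p0) (p1_gt0 : 0 < p1) (a_gt0 : 0 < a) (b_gt0 : 0 < b)
  (D_pi : 0 < D < pi / 2) (abD : a + b <= 2 * D)
  (crossS : n0 * n1 * sin (a + b) = (p0 + p1) * A)
  (crossa : n0 * n * sin a = p0 * A) (crossb : n * n1 * sin b = p1 * A)
  (u0_le1 : `|u0| <= 1) (u1_le1 : `|u1| <= 1).

Let S_gt0 : 0 < sin (a + b).
Proof.
have /andP[D0 Dpi] := D_pi; have a0 := a_gt0; have b0 := b_gt0.
by have ab := abD; apply: sin_gt0_pi; lra.
Qed.

Let weights_error :
  `|sin b * u0 + sin a * u1 - sin (a + b) * ((b * u0 + a * u1) / (a + b))|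
     <= a * b * sin (a + b) / (2 * cos D).
Proof. by have /andP[? ?] := D_pi; exact: sin_weights_error. Qed.

(** After passing to sine weights, multiplication by [n0 * n * n1] and the cross relations turn them
    into [p0] and [p1], with a common factor [A]. *)
Lemma seg_semiconvex_of_angle (C W : R) : 0 <= q -> 0 <= C ->
    A <= q * n0 -> A <= q * n -> 1 <= n1 * W ->
    (a + b) * u <= b * u0 + a * u1 + C * (a * b * (a + b)) ->
  (p0 + p1) * (n * u) <= p1 * (n0 * u0) + p0 * (n1 * u1)
    + (C + (2 * cos D)^-1) * (2 * D / sin (2 * D)) ^+ 2 * W * q ^+ 2
      * (p0 * p1 * (p0 + p1)).
Proof.
move=> q0 C0 An0 An n1W H; have /andP[D0 Dpi] := D_pi.
have ab0 : 0 < a + b by rewrite addr_gt0.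
have cD : 0 < cos D by apply: cos_gt0_pihalf; lra.
have := seg_weights_le (ltW a_gt0) (ltW b_gt0) abD D_pi.
move: (2 * D / sin (2 * D)) => c abss.
set E := C + (2 * cos D)^-1.
have E0 : 0 <= E by rewrite addr_ge0// invr_ge0 mulr_ge0// ltW.
have Su : sin (a + b) * u
    <= sin b * u0 + sin a * u1 + E * (a * b * sin (a + b)).
  move: weights_error; rewrite ler_norml => /andP[lo _].
  have : sin (a + b) * u <= sin (a + b) * ((b * u0 + a * u1) / (a + b))
      + C * (a * b * sin (a + b)).
    have -> : sin (a + b) * ((b * u0 + a * u1) / (a + b))
        + C * (a * b * sin (a + b))
      = sin (a + b) / (a + b) * (b * u0 + a * u1 + C * (a * b * (a + b))).
      by field; rewrite gt_eqF.
    have -> : sin (a + b) * u = sin (a + b) / (a + b) * ((a + b) * u).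
      by field; rewrite gt_eqF.
    by rewrite ler_wpM2l// divr_ge0 ?ltW.
  by rewrite /E; lra.
have nnn : 0 < n0 * n * n1 by rewrite !mulr_gt0.
have : A * ((p0 + p1) * (n * u)) <= A * (p1 * (n0 * u0) + p0 * (n1 * u1)
    + E * (a * b * n * (p0 + p1))).
  have := ler_wpM2l (ltW nnn) Su.
  have -> : n0 * n * n1 * (sin (a + b) * u)
    = n * u * (n0 * n1 * sin (a + b)) by ring.
  have -> : n0 * n * n1 * (sin b * u0 + sin a * u1 + E * (a * b * sin (a + b)))
    = n0 * u0 * (n * n1 * sin b) + n1 * u1 * (n0 * n * sin a)
      + E * (a * b * n * (n0 * n1 * sin (a + b))) by ring.
  by rewrite crossS crossa crossb; lra.
rewrite ler_pM2l// => /le_trans; apply; rewrite lerD2l -!mulrA ler_wpM2l//.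
suff : a * b * n <= c ^+ 2 * (W * q ^+ 2 * (p0 * p1)).
  by move=> /(ler_wpM2r (ltW (addr_gt0 p0_gt0 p1_gt0))); lra.
apply: (le_trans (ler_wpM2r (ltW n_gt0) abss)).
rewrite -[leLHS]mulrA ler_wpM2l ?sqr_ge0// -(ler_pM2l nnn).
have -> : n0 * n * n1 * (sin a * sin b * n)
  = n0 * n * sin a * (n * n1 * sin b) by ring.
rewrite crossa crossb.
(* Two of the norms are bounded below by the height [A / q], the third by the inverse of [W]. *)
have AA : A ^+ 2 <= q ^+ 2 * (n0 * n) * (n1 * W).
  apply: (@le_trans _ _ (q ^+ 2 * (n0 * n))).
    by rewrite !expr2 mulrACA ler_pM// ltW.
  by rewrite ler_peMr// !mulr_ge0// ltW.
by have := ler_wpM2l (ltW (mulr_gt0 p0_gt0 p1_gt0)) AA; lra.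
Qed.

Lemma angle_semiconvex_of_seg (M r : R) : 0 <= M ->
    n0 <= r -> n <= r -> n1 <= r -> q ^+ 2 * (r * cos D) ^+ 2 <= A ^+ 2 ->
    (p0 + p1) * (n * u) <= p1 * (n0 * u0) + p0 * (n1 * u1)
      + M * q ^+ 2 * (p0 * p1 * (p0 + p1)) ->
  (a + b) * u <= b * u0 + a * u1
    + (M * (r / cos D ^+ 2) + (2 * cos D)^-1) * (a * b * (a + b)).
Proof.
move=> M0 n0r nr n1r qA H; have /andP[D0 Dpi] := D_pi.
have ab0 : 0 < a + b by rewrite addr_gt0.
have cD : 0 < cos D by apply: cos_gt0_pihalf; lra.
have r0 : 0 < r by apply: lt_le_trans n0r.
have a0 := a_gt0; have b0 := b_gt0; have ab := abD.
have nnn : 0 < n0 * n * n1 by rewrite !mulr_gt0.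
have Su : sin (a + b) * u <= sin b * u0 + sin a * u1
    + M * (r / cos D ^+ 2) * (a * b * sin (a + b)).
  have sa0 : 0 <= sin a by apply: sin_ge0_pi; lra.
  have sb0 : 0 <= sin b by apply: sin_ge0_pi; lra.
  (* The norms are at most [r] and the sines at most the angles; then the lower bound on [A] trades
     [q ^+ 2 * r ^+ 3] for [r / cos D ^+ 2 * A ^+ 2]. *)
  have q2 : q ^+ 2 * (n0 * n * n1) * (sin a * sin b)
      <= r / cos D ^+ 2 * (a * b) * A ^+ 2.
    apply: (@le_trans _ _ (q ^+ 2 * r ^+ 3 * (a * b))).
      apply: ler_pM.
      - by rewrite mulr_ge0 ?sqr_ge0 ?ltW.
      - by rewrite mulr_ge0.
      - rewrite ler_wpM2l ?sqr_ge0// !exprS expr0 mulr1 mulrA.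
        by rewrite !ler_pM ?mulr_ge0// ltW.
      - by rewrite ler_pM// sin_le// ltW.
    have -> : q ^+ 2 * r ^+ 3 * (a * b)
        = r / cos D ^+ 2 * (a * b) * (q ^+ 2 * (r * cos D) ^+ 2).
      by field; rewrite gt_eqF.
    by rewrite ler_wpM2l// !mulr_ge0 ?invr_ge0 ?sqr_ge0 ?ltW.
  have AA : 0 < A ^+ 2 by rewrite exprn_gt0.
  rewrite -(ler_pM2l (mulr_gt0 nnn AA)).
  have -> : n0 * n * n1 * A ^+ 2 * (sin (a + b) * u)
    = A ^+ 2 * (n * u * (n0 * n1 * sin (a + b))) by ring.
  rewrite crossS.
  have {}H := ler_wpM2l (exprn_ge0 3 (ltW A_gt0)) H.
  have -> : A ^+ 2 * (n * u * ((p0 + p1) * A))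
    = A ^+ 3 * ((p0 + p1) * (n * u)) by ring.
  apply: (le_trans H).
  have -> : A ^+ 3 * (p1 * (n0 * u0) + p0 * (n1 * u1)
      + M * q ^+ 2 * (p0 * p1 * (p0 + p1)))
    = A ^+ 2 * (p1 * A * (n0 * u0) + p0 * A * (n1 * u1))
      + M * q ^+ 2 * (p0 * A * (p1 * A) * ((p0 + p1) * A)) by ring.
  rewrite -crossS -crossa -crossb.
  have := ler_wpM2l (mulr_ge0 M0 (ltW (mulr_gt0 nnn S_gt0))) q2; lra.
move: weights_error; rewrite ler_norml => /andP[_ hi].
set F := M * (r / cos D ^+ 2) in Su *.
have : sin (a + b) * u <= sin (a + b) * ((b * u0 + a * u1) / (a + b))
    + (F + (2 * cos D)^-1) * (a * b * sin (a + b)) by lra.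
move=> /(ler_wpM2l (ltW (divr_gt0 ab0 S_gt0))); congr (_ <= _).
  by field; rewrite gt_eqF.
by field; rewrite !gt_eqF.
Qed.

End SegmentWeights.

Lemma cone_sqr_dist_semiconcave K r0 r1 r2 phi D q d :
    0 < r0 -> 0 < r1 -> 0 <= r2 -> 0 < phi <= 2 * D -> D < pi / 2 ->
    0 <= q -> q ^+ 2 = r0 ^+ 2 + r1 ^+ 2 - 2 * r0 * r1 * cos phi ->
    (forall s, 0 <= d s) ->
    semiconcave (K * phi ^+ 2) (fun s => d s ^+ 2) ->
  semiconcave (cone_const K r0 r1 r2 D * q ^+ 2)
    (cone_sqr_dist r0 r1 r2 phi d).
Proof.
move=> r00 r10 r20 /andP[phi0 phiD] Dpi q0 qE d0 /semiconcaveP dK.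
have pi0 := @pi_gt0 R.
have D0 : 0 < D by lra.
have cD : 0 < cos D by apply: cos_gt0_pihalf; lra.
have phi_pi : 0 < phi < pi by lra.
have sphi := sin_gt0_pi phi_pi.
apply/semiconcaveP => t0 t t1 t00 t0t tt1 t11; rewrite /cone_sqr_dist.
have t0I : 0 <= t0 <= 1 by lra.
have tI : 0 <= t <= 1 by lra.
have t1I : 0 <= t1 <= 1 by lra.
have n0 := seg_norm_gt0 r00 r10 phi_pi t0I.
have n := seg_norm_gt0 r00 r10 phi_pi tI.
have n1 := seg_norm_gt0 r00 r10 phi_pi t1I.
have /= := seg_norm_stewart (ltW r00) (ltW r10) qE t0I tI t1I.
have /andP[x0 _] := seg_angle_bound r00 r10 phi_pi t0I.
have /andP[_ x1] := seg_angle_bound r00 r10 phi_pi t1I.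
have /= := seg_triple r00 r10 phi_pi t00 t0t tt1 t11.
have h0 := seg_norm_ge_height r00 r10 phi_pi q0 qE t0I.
have h := seg_norm_ge_height r00 r10 phi_pi q0 qE tI.
have phiD' : 0 <= phi <= 2 * D by rewrite ltW.
have n1D := seg_norm_ge (ltW r00) (ltW r10) t1I phiD' Dpi.
move=> [[a0 b0 abphi] crossS crossa crossb] stewart.
set w0 := seg_angle r0 r1 phi t0 in x0 a0 b0 abphi crossS crossa *.
set w1 := seg_angle r0 r1 phi t1 in x1 a0 b0 abphi crossS crossb *.
set w := seg_angle r0 r1 phi t in a0 b0 abphi crossS crossa crossb *.
set a := w - w0 in a0 abphi crossS crossa.
set b := w1 - w in b0 abphi crossS crossb.
(* A convex combination of [r0] and [r1] times [r0^-1 + r1^-1] is at least 1. *)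
have W : 1 <= seg_norm r0 r1 phi t1 * ((r0^-1 + r1^-1) / cos D).
  rewrite mulrA ler_pdivlMr// mul1r.
  have W0 : 0 <= r0^-1 + r1^-1 by rewrite addr_ge0 ?invr_ge0 ?ltW.
  apply: le_trans (ler_wpM2r W0 n1D).
  rewrite -mulrA ler_peMr//; first exact: ltW.
  have -> : ((1 - t1) * r0 + t1 * r1) * (r0^-1 + r1^-1)
    = 1 + ((1 - t1) * r0 / r1 + t1 * r1 / r0).
    by field; rewrite !gt_eqF.
  by rewrite lerDl addr_ge0// divr_ge0 ?mulr_ge0//; lra.
have K0 : 0 <= `|K| / 2 by rewrite divr_ge0.
have DD : 0 < D < pi / 2 by rewrite D0.
have abD : a + b <= 2 * D by apply: le_trans phiD.
have cosd w' := cos_max (Num.min pi (d (phi^-1 * w'))).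
(* Semiconcavity read in the angle [phi * s]: the rescaling cancels [phi ^+ 2]. *)
have key : b * d (phi^-1 * w0) ^+ 2 + a * d (phi^-1 * w1) ^+ 2
    <= (a + b) * d (phi^-1 * w) ^+ 2 + K * (a * b * (a + b)).
  have := dK (phi^-1 * w0) (phi^-1 * w) (phi^-1 * w1).
  rewrite !ltr_pM2l ?invr_gt0// mulr_ge0 ?invr_ge0 ?(ltW phi0)//.
  rewrite -(subr_gt0 w0) -(subr_gt0 w) -/a -/b a0 b0 (mulrC _ w1).
  rewrite ler_pdivrMr// mul1r x1 => /(_ isT isT isT isT).
  rewrite -(ler_pM2l phi0) (mulrC w1); congr (_ <= _); rewrite /a /b.
    by field; rewrite gt_eqF.
  by field; rewrite gt_eqF.
have := sqr_semiconcave_cos a0 b0 (d0 _) (d0 _) (d0 _) key.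
have p0 : 0 < t - t0 by rewrite subr_gt0.
have p1 : 0 < t1 - t by rewrite subr_gt0.
have A0 : 0 < r0 * r1 * sin phi by rewrite !mulr_gt0.
have pp : t1 - t0 = (t - t0) + (t1 - t) by ring.
rewrite pp in crossS stewart *.
move=> /(seg_semiconvex_of_angle n0 n n1 A0 p0 p1 a0 b0 DD abD crossS crossa
  crossb (cosd _) (cosd _) q0 K0 h0 h W).
set u0 := cos (Num.min pi (d (phi^-1 * w0))).
set u := cos (Num.min pi (d (phi^-1 * w))).
set u1 := cos (Num.min pi (d (phi^-1 * w1))).
move=> /(ler_wpM2l r20) H.
(* The first [q ^+ 2] is Stewart's term; the rest is [2 * r2] times the error for [n * u]. *)
have -> : cone_const K r0 r1 r2 D * q ^+ 2 = q ^+ 2 + 2 * r2 *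
   ((`|K| / 2 + (2 * cos D)^-1) * (2 * D / sin (2 * D)) ^+ 2
    * ((r0^-1 + r1^-1) / cos D) * q ^+ 2).
  rewrite /cone_const; move: (2 * D / _) ((_ + _) / _) => x y.
  by field; rewrite gt_eqF.
lra.
Qed.

Lemma semiconcave_of_cone_sqr_dist K r r2 phi D q d :
    0 < r -> 0 < r2 -> 0 < phi <= 2 * D -> D < pi / 2 ->
    0 <= q -> q ^+ 2 = r ^+ 2 + r ^+ 2 - 2 * r * r * cos phi ->
    (forall s : R, 0 <= s <= 1 -> 0 <= d s <= 2 * D) ->
    (forall s t : R, 0 <= s <= 1 -> 0 <= t <= 1 ->
       `|d s - d t| <= phi * `|s - t|) ->
    semiconcave (K * q ^+ 2) (cone_sqr_dist r r r2 phi d) ->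
  semiconcave (base_const K r r2 D * phi ^+ 2) (fun s => d s ^+ 2).
Proof.
move=> r0 r20 /andP[phi0 phiD] Dpi q0 qE dD dlip /semiconcaveP H.
have pi0 := @pi_gt0 R.
have D0 : 0 < D by lra.
have cD : 0 < cos D by apply: cos_gt0_pihalf; lra.
have phi_pi : 0 < phi < pi by lra.
have sphi := sin_gt0_pi phi_pi.
apply/semiconcaveP => s0 s s1 s00 s0s ss1 s11.
(* The triple in [s] is pulled back to parameters [t] of the segment, where the cone hypothesis
   applies. *)
have angle z : 0 <= z <= 1 -> exists2 t, 0 <= t <= 1
    & seg_angle r r phi t = phi * z.
  move=> /andP[z0 z1]; have [] := @seg_isosceles R r phi (phi * z) r0 phi_pi.
    by rewrite mulr_ge0 ?(ltW phi0)//= ler_piMr// ltW.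
  by set t := sin _ / _ => ? ?; exists t.
have s0I : 0 <= s0 <= 1 by lra.
have sI : 0 <= s <= 1 by lra.
have s1I : 0 <= s1 <= 1 by lra.
have [t0 t0I w0E] := angle _ s0I.
have [t tI wE] := angle _ sI.
have [t1 t1I w1E] := angle _ s1I.
have lt_seg x y : 0 <= x <= 1 -> 0 <= y <= 1 ->
    seg_angle r r phi x < seg_angle r r phi y -> x < y.
  move=> /andP[x0 x1] /andP[y0 y1]; apply: contraTT; rewrite -!leNgt.
  rewrite le_eqVlt => /predU1P[->//|yx].
  by rewrite ltW// seg_angle_lt.
have t0t : t0 < t by apply: lt_seg; rewrite // w0E wE ltr_pM2l.
have tt1 : t < t1 by apply: lt_seg; rewrite // w1E wE ltr_pM2l.
have /andP[t00 _] := t0I; have /andP[_ t11] := t1I.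
have n0 := seg_norm_gt0 r0 r0 phi_pi t0I.
have n := seg_norm_gt0 r0 r0 phi_pi tI.
have n1 := seg_norm_gt0 r0 r0 phi_pi t1I.
have /= := seg_norm_stewart (ltW r0) (ltW r0) qE t0I tI t1I.
have /= := seg_triple r0 r0 phi_pi t00 t0t tt1 t11.
move=> [[a0 b0 abphi] crossS crossa crossb] stewart.
have := H t0 t t1 t00 t0t tt1 t11.
rewrite /cone_sqr_dist.
rewrite w0E wE w1E in a0 b0 abphi crossS crossa crossb *.
rewrite !mulKf ?gt_eqF//.
rewrite -!mulrBr in a0 b0 abphi crossS crossa crossb.
have norm_le x : 0 <= x <= 1 -> seg_norm r r phi x <= r.
  move=> xI; have /andP[x0 x1] := xI.
  rewrite -ler_sqr ?nnegrE ?sqrtr_ge0 ?(ltW r0)// sqr_seg_norm ?(ltW r0)//.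
  have : 0 <= r ^+ 2 * (x * (1 - x)) * (1 - cos phi).
    rewrite mulr_ge0 ?subr_ge0 ?cos_le1// mulr_ge0 ?sqr_ge0//.
    by rewrite mulr_ge0 ?subr_ge0.
  lra.
(* The distances stay below [pi], so the truncation disappears. *)
have minE z : 0 <= z <= 1 -> Num.min pi (d z) = d z.
  by move=> /dD/andP[_ dz]; rewrite min_r//; lra.
rewrite !minE//.
set a := phi * (s - s0) in a0 abphi crossS crossa *.
set b := phi * (s1 - s) in b0 abphi crossS crossb *.
have p0 : 0 < t - t0 by rewrite subr_gt0.
have p1 : 0 < t1 - t by rewrite subr_gt0.
have A0 : 0 < r * r * sin phi by rewrite !mulr_gt0.
have pp : t1 - t0 = (t - t0) + (t1 - t) by ring.
rewrite pp in crossS stewart * => HH.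
(* Stewart's identity uses up one [q ^+ 2] out of [K * q ^+ 2]; division by [2 * r2] isolates
   [n * u]. *)
pose M := `|K - 1| / (2 * r2).
have M0 : 0 <= M by rewrite divr_ge0// mulr_ge0// ltW.
have DD : 0 < D < pi / 2 by rewrite D0.
have abD : a + b <= 2 * D by apply: le_trans phiD.
(* Here [q ^+ 2 = 2 * r ^+ 2 * (1 - cos phi)], so the claim reduces to
   [2 * cos D ^+ 2 <= 1 + cos phi]. *)
have qA : q ^+ 2 * (r * cos D) ^+ 2 <= (r * r * sin phi) ^+ 2.
  rewrite qE [leRHS]exprMn sin2cos2.
  have c2D : cos D ^+ 2 *+ 2 <= 1 + cos phi.
    rewrite -lerBlDl -cos_mulr2n leNgt ltr_cos ?in_itv/= -?leNgt//; lra.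
  have : 0 <= r ^+ 4 * (1 - cos phi).
    by rewrite mulr_ge0 ?subr_ge0 ?cos_le1// exprn_ge0// ltW.
  by move=> /ler_wpM2l/(_ _ _ c2D); lra.
have {}HH : (t - t0 + (t1 - t)) * (seg_norm r r phi t * cos (d s))
  <= (t1 - t) * (seg_norm r r phi t0 * cos (d s0))
    + (t - t0) * (seg_norm r r phi t1 * cos (d s1))
    + M * q ^+ 2 * ((t - t0) * (t1 - t) * (t - t0 + (t1 - t))).
  have r22 : 0 < 2 * r2 by rewrite mulr_gt0.
  set P := (t - t0) * (t1 - t) * (t - t0 + (t1 - t)).
  have P0 : 0 <= q ^+ 2 * P.
    by rewrite mulr_ge0 ?sqr_ge0//; apply/ltW; rewrite !mulr_gt0// addr_gt0.
  rewrite -(ler_pM2l r22).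
  have -> : forall x, 2 * r2 * (x + M * q ^+ 2 * P)
      = 2 * r2 * x + `|K - 1| * (q ^+ 2 * P).
    by move=> x; rewrite /M; field; rewrite gt_eqF.
  have := ler_wpM2r P0 (ler_norm (K - 1)); rewrite /P; lra.
have := angle_semiconvex_of_seg n0 n n1 A0 a0 b0 DD abD crossS crossa
  crossb (cos_max _) (cos_max _) M0 (norm_le _ t0I) (norm_le _ tI)
  (norm_le _ t1I) qA HH.
have C0 : 0 <= M * (r / cos D ^+ 2) + (2 * cos D)^-1.
  rewrite addr_ge0//; first by rewrite mulr_ge0// divr_ge0 ?sqr_ge0// ltW.
  by rewrite invr_ge0 mulr_ge0// ltW.
have d0a : `|d s0 - d s| <= a.
  have := dlip _ _ s0I sI.
  by rewrite (distrC s0) [`|s - s0|]gtr0_norm ?subr_gt0.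
have d1b : `|d s1 - d s| <= b.
  by have := dlip _ _ s1I sI; rewrite [`|s1 - s|]gtr0_norm ?subr_gt0.
move=> /(cos_semiconvex_sqr a0 b0 Dpi C0 (dD _ s0I) (dD _ sI) (dD _ s1I)
  d0a d1b).
rewrite {1}/sinc gt_eqF ?mulr_gt0// -/(base_const K r r2 D).
rewrite /a /b => {}H.
rewrite -(ler_pM2l phi0); lra.
Qed.

End ConeEstimates.

(** * Continuous dependence of the constants *)

Lemma cvg_comp_fst (U V W : topologicalType) (f : U -> W) (p : U * V) (l : W) :
  f @ p.1 --> l -> f q.1 @[q --> p] --> l.
Proof. by move=> fl; exact: (cvg_comp _ _ cvg_fst fl). Qed.

Section Constants.
Context {R : realType}.

Lemma cvg_cone_const (T : Type) (F : set_system T) (FF : Filter F)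
    (K r0 r1 r2 D : T -> R) (k a b c e : R) :
    a != 0 -> b != 0 -> 0 < e < pi / 2 ->
    K @ F --> k -> r0 @ F --> a -> r1 @ F --> b -> r2 @ F --> c ->
    D @ F --> e ->
  cone_const (K x) (r0 x) (r1 x) (r2 x) (D x) @[x --> F]
    --> cone_const k a b c e.
Proof.
move=> a0 b0 /andP[e0 epi] Kk r0a r1b r2c De.
have ce : cos e != 0 by rewrite gt_eqF// cos_gt0_pihalf//; lra.
have se : sin (2 * e) != 0 by rewrite gt_eqF// sin_gt0_pi//; lra.
have cosD : cos (D x) @[x --> F] --> cos e.
  exact: (cvg_comp _ _ De (@continuous_cos R _)).
have D2 : 2 * D x @[x --> F] --> 2 * e by apply: cvgM => //; exact: cvg_cst.
have sinD : sin (2 * D x) @[x --> F] --> sin (2 * e).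
  exact: (cvg_comp _ _ D2 (@continuous_sin R _)).
have cosV : (cos (D x))^-1 @[x --> F] --> (cos e)^-1 by exact: cvgV.
apply: cvgD; first exact: cvg_cst.
apply: cvgM; last first.
  by apply: cvgM => //; apply: cvgD; exact: cvgV.
apply: cvgM.
  by apply: cvgM => //; apply: cvgD => //; exact: cvg_norm.
have c2 : 2 * D x / sin (2 * D x) @[x --> F] --> 2 * e / sin (2 * e).
  by apply: cvgM => //; exact: cvgV.
under eq_fun do rewrite expr2.
by rewrite expr2; exact: cvgM.
Qed.

Lemma cvg_base_const (T : Type) (F : set_system T) (FF : Filter F)
    (K r0 r2 D : T -> R) (k a c e : R) :
    c != 0 -> 0 < e < pi / 2 ->
    K @ F --> k -> r0 @ F --> a -> r2 @ F --> c -> D @ F --> e ->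
  base_const (K x) (r0 x) (r2 x) (D x) @[x --> F] --> base_const k a c e.
Proof.
move=> c0 /andP[e0 epi] Kk r0a r2c De.
have ce : cos e != 0 by rewrite gt_eqF// cos_gt0_pihalf//; lra.
have se : sin (2 * e) != 0 by rewrite gt_eqF// sin_gt0_pi//; lra.
have sqr (f : T -> R) (l : R) : f @ F --> l -> f x ^+ 2 @[x --> F] --> l ^+ 2.
  by move=> fl; rewrite expr2; under eq_fun do rewrite expr2; exact: cvgM.
have scale (z l : R) (f : T -> R) : f @ F --> l -> z * f x @[x --> F] --> z * l.
  by move=> fl; apply: cvgM => //; exact: cvg_cst.
have cosD : cos (D x) @[x --> F] --> cos e.
  exact: (cvg_comp _ _ De (@continuous_cos R _)).
have sinD : sin (2 * D x) @[x --> F] --> sin (2 * e).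
  exact: (cvg_comp _ _ (scale 2 _ _ De) (@continuous_sin R _)).
apply: cvgM; last first.
  have e2 : 2 * e != 0 by rewrite gt_eqF// mulr_gt0.
  apply: (scale); apply: cvgV; first by rewrite mulf_neq0// invr_neq0.
  by apply: cvgM => //; apply: cvgV => //; exact: (scale).
apply: cvgD; last by apply: (scale); exact: sqr.
apply: cvgD; last by apply: cvgV; [rewrite mulf_neq0//|exact: (scale)].
apply: cvgM.
  apply: cvgM; last by apply: cvgV; [rewrite mulf_neq0//|exact: (scale)].
  by apply: cvg_norm; apply: cvgB => //; exact: cvg_cst.
by apply: cvgM => //; apply: cvgV; [rewrite expf_neq0|exact: sqr].
Qed.

End Constants.

(** * Squared distances along the curve, and curves ending at the apex *)

Section ConeGeodesic.
Context {R : realType} (X : metricType R).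
Implicit Types (x y : X) (r : {nonneg R}) (g : R -> X) (t : R).

Lemma sqr_mdist_cone_pt x r y r' :
  mdist (cone_pt x r) (cone_pt y r') ^+ 2 = r%:num ^+ 2 + r'%:num ^+ 2
    - 2 * r%:num * r'%:num * cos (Num.min pi (mdist x y)).
Proof. by rewrite mdist_cone_pt sqr_sqrtr// cone_radicand_ge0. Qed.

Lemma ball_mdist_lt x y z (D : R) : ball x D y -> ball x D z ->
  mdist y z < 2 * D.
Proof.
rewrite !ballEmdist/= => xy xz; have := metric_triangle y x z.
by rewrite (metric_sym y x); lra.
Qed.

Lemma sqr_mdist_cone_geodesic x0 r0 x1 r1 x2 r2 g t : x0 != x1 ->
  mdist (cone_pt x2 r2) (cone_geodesic x0 r0 x1 r1 g t) ^+ 2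
    = cone_sqr_dist r0%:num r1%:num r2%:num (mdist x0 x1)
        (fun s => mdist x2 (g s)) t.
Proof.
by move=> x01; rewrite /cone_geodesic (negPf x01) sqr_mdist_cone_pt.
Qed.

End ConeGeodesic.

Lemma semiconcave_quadratic (R : realType) (a b c K : R) (f : R -> R) :
  (forall t, 0 <= t <= 1 -> f t = a + b * t + c * t ^+ 2) -> c <= K ->
  semiconcave K f.
Proof.
move=> fE cK; apply/semiconcaveP => s0 s s1 s00 s0s ss1 s11.
rewrite !fE; [|lra..].
have P0 : 0 <= (s1 - s) * (s - s0) * (s1 - s0) by rewrite !mulr_ge0//; lra.
by have := ler_wpM2r P0 cK; lra.
Qed.

Section Degenerate.
Context {R : realType}.
Implicit Types (r phi t : R).

(** The segment lies on the ray of angle [phi], so only [d 1] matters. Where the norm vanishes, the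
    angle is a default value multiplied by 0. *)
Lemma cone_sqr_dist_r0 r1 r2 phi (d : R -> R) t : 0 <= r1 -> 0 < phi < pi ->
    0 <= t <= 1 ->
  cone_sqr_dist 0 r1 r2 phi d t
    = r2 ^+ 2 + (- 2 * r2 * r1 * cos (Num.min pi (d 1))) * t
      + r1 ^+ 2 * t ^+ 2.
Proof.
move=> r10 /andP[phi0 phipi] /andP[t0 t1]; rewrite /cone_sqr_dist.
have nE : seg_norm 0 r1 phi t = t * r1.
  rewrite /seg_norm -[RHS]ger0_norm ?mulr_ge0// -sqrtr_sqr.
  by congr Num.sqrt; ring.
have -> : r2 ^+ 2 + (- 2 * r2 * r1 * cos (Num.min pi (d 1))) * t
    + r1 ^+ 2 * t ^+ 2
  = r2 ^+ 2 + (t * r1) ^+ 2 - 2 * r2 * (t * r1) * cos (Num.min pi (d 1)).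
  by ring.
rewrite nE; have [->|tr_neq0] := eqVneq (t * r1) 0.
  by rewrite !mulr0 !mul0r.
have -> : seg_angle 0 r1 phi t = phi.
  rewrite /seg_angle nE mulr0 add0r mulrC mulKf//.
  by rewrite cosK// in_itv/= !ltW.
by rewrite mulVf ?gt_eqF.
Qed.

(** Likewise on the ray of angle 0, where only [d 0] matters. *)
Lemma cone_sqr_dist_r1 r0 r2 phi (d : R -> R) t : 0 <= r0 -> 0 <= t <= 1 ->
  cone_sqr_dist r0 0 r2 phi d t
    = (r2 ^+ 2 + r0 ^+ 2 - 2 * r2 * r0 * cos (Num.min pi (d 0)))
      + (2 * r2 * r0 * cos (Num.min pi (d 0)) - 2 * r0 ^+ 2) * t
      + r0 ^+ 2 * t ^+ 2.
Proof.
move=> r00 /andP[t0 t1]; rewrite /cone_sqr_dist.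
have nE : seg_norm r0 0 phi t = (1 - t) * r0.
  rewrite /seg_norm -[RHS]ger0_norm ?mulr_ge0// ?subr_ge0//.
  by rewrite -sqrtr_sqr; congr Num.sqrt; ring.
transitivity (r2 ^+ 2 + ((1 - t) * r0) ^+ 2
    - 2 * r2 * ((1 - t) * r0) * cos (Num.min pi (d 0))); last by ring.
rewrite nE; have [->|tr_neq0] := eqVneq ((1 - t) * r0) 0.
  by rewrite !mulr0 !mul0r.
by rewrite /seg_angle nE mulr0 mul0r addr0 divff// acos1 mulr0.
Qed.

End Degenerate.

(** * Semiconcavity in the cone and in the base *)

Section SemiconcaveAlong.
Context {R : realType} {X : metricType R}.
Variables (x0 x1 x2 x : X) (r0 r1 r2 : {nonneg R}) (x01 : R -> X) (D K : R).
Hypotheses (x01_geod : Geod x0 x1 x01) (D_pi : D < pi / 2)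
  (xD0 : ball x D x0) (xD1 : ball x D x1).

Let D_gt0 : 0 < D.
Proof. by move: xD0; rewrite ballEmdist/=; apply/le_lt_trans/mdist_ge0. Qed.

Let min_pi_dist : Num.min pi (mdist x0 x1) = mdist x0 x1.
Proof.
have := ball_mdist_lt xD0 xD1; have := D_pi => ? ?.
by rewrite min_r//; lra.
Qed.

(** If [x0 = x1] or a radius vanishes, the squared distance is quadratic in [t] with the squared
    cone distance as leading coefficient, and a constant at least 1 suffices. Otherwise the planar
    estimate applies. *)
Lemma cone_semiconcave_along : semiconcave_along K x0 x1 x01 x2 ->
  semiconcave_along (cone_const K r0%:num r1%:num r2%:num D)
    (cone_pt x0 r0) (cone_pt x1 r1) (cone_geodesic x0 r0 x1 r1 x01)
    (cone_pt x2 r2).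
Proof.
rewrite /semiconcave_along => dK.
have [g0 g1 _] := x01_geod; have D0 := D_gt0; have Dpi := D_pi.
have DD : 0 < D < pi / 2 by rewrite D0.
have C1 : 1 <= cone_const K r0%:num r1%:num r2%:num D.
  exact: cone_const_ge1.
have qE := sqr_mdist_cone_pt x0 r0 x1 r1; rewrite min_pi_dist in qE.
have q0 := sqr_ge0 (mdist (cone_pt x0 r0) (cone_pt x1 r1)).
have quadratic a b : (forall t : R, 0 <= t <= 1 ->
    mdist (cone_pt x2 r2) (cone_geodesic x0 r0 x1 r1 x01 t) ^+ 2 =
    a + b * t + mdist (cone_pt x0 r0) (cone_pt x1 r1) ^+ 2 * t ^+ 2) ->
    semiconcave (cone_const K r0%:num r1%:num r2%:num D
        * mdist (cone_pt x0 r0) (cone_pt x1 r1) ^+ 2)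
      (fun t => mdist (cone_pt x2 r2)
                  (cone_geodesic x0 r0 x1 r1 x01 t) ^+ 2).
  move=> fE; apply: (semiconcave_quadratic fE). exact: ler_peMl.
have [xx|x_neq] := eqVneq x0 x1.
  set c := 2 * r2%:num * cos (Num.min pi (mdist x2 x0)).
  apply: (quadratic (r2%:num ^+ 2 + r0%:num ^+ 2 - c * r0%:num)
    (2 * r0%:num * (r1%:num - r0%:num) - c * (r1%:num - r0%:num))).
  move=> t /andP[t0 t1]; rewrite qE /cone_geodesic {1}xx eqxx.
  rewrite sqr_mdist_cone_pt -xx mdistxx cos0 /= ger0_norm.
    by rewrite /c; ring.
  by rewrite addr_ge0// mulr_ge0// subr_ge0.
have phi0 : 0 < mdist x0 x1 by rewrite mdist_gt0.
have phiD := ltW (ball_mdist_lt xD0 xD1).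
have phipi : 0 < mdist x0 x1 < pi by rewrite phi0/=; lra.
have [r00|r0_neq0] := eqVneq (r0%:num) (0 : R).
  rewrite r00 (_ : _ - _ = r1%:num ^+ 2) in qE; last by ring.
  apply: quadratic => t tI; rewrite sqr_mdist_cone_geodesic// qE r00.
  exact: cone_sqr_dist_r0.
have [r10|r1_neq0] := eqVneq (r1%:num) (0 : R).
  rewrite r10 (_ : _ - _ = r0%:num ^+ 2) in qE; last by ring.
  apply: quadratic => t tI; rewrite sqr_mdist_cone_geodesic// qE r10.
  exact: cone_sqr_dist_r1.
have r00 : 0 < r0%:num :> R by rewrite lt0r r0_neq0/=.
have r10 : 0 < r1%:num :> R by rewrite lt0r r1_neq0/=.
under eq_fun do rewrite sqr_mdist_cone_geodesic//.
by apply: cone_sqr_dist_semiconcave => // [||s]; rewrite ?phi0 ?mdist_ge0.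
Qed.

Hypotheses (x01_neq : x0 <> x1) (r01 : r0 = r1) (r0_gt0 : 0 < r0%:num)
  (r2_gt0 : 0 < r2%:num)
  (dD : forall t : R, 0 <= t <= 1 -> mdist x2 (x01 t) <= 2 * D).

Lemma base_semiconcave_along :
  semiconcave_along K (cone_pt x0 r0) (cone_pt x1 r1)
    (cone_geodesic x0 r0 x1 r1 x01) (cone_pt x2 r2) ->
  semiconcave_along (base_const K r0%:num r2%:num D) x0 x1 x01 x2.
Proof.
rewrite /semiconcave_along.
have /eqP x_neq := x01_neq; have [_ _ g_lip] := x01_geod.
under eq_fun do rewrite sqr_mdist_cone_geodesic//.
have phi0 : 0 < mdist x0 x1 by rewrite mdist_gt0.
have phiD := ltW (ball_mdist_lt xD0 xD1).
have qE := sqr_mdist_cone_pt x0 r0 x1 r1; rewrite min_pi_dist in qE.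
rewrite -r01 in qE *.
apply: semiconcave_of_cone_sqr_dist => //.
- by rewrite phi0.
- exact: mdist_ge0.
- by move=> t tI; rewrite mdist_ge0 dD.
(* The distance to [x2] is 1-Lipschitz and [x01] has constant speed. *)
move=> s t sI tI; rewrite mulrC -g_lip// ler_norml.
have := metric_triangle x2 (x01 s) (x01 t).
have := metric_triangle x2 (x01 t) (x01 s).
by rewrite (metric_sym (x01 t) (x01 s)); lra.
Qed.

End SemiconcaveAlong.

Theorem proposition2p27 (R : realType) :
  (* (A) *)
  (exists K' : R * R * R * R * R -> R,
     {within [set p : R * R * R * R * R |
                let: (K, r0, r1, r2, D) := p in
                [/\ 0 < r0, 0 < r1, 0 <= r2 & 0 < D < pi / 2]],
       continuous K'} /\
     forall (X : metricType R) (x0 x1 x2 : X) (r0 r1 r2 : {nonneg R})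
            (x01 : R -> X) (x : X) (D K : R),
       geodesic_space X -> Geod x0 x1 x01 -> D < pi / 2 ->
       ball x D x0 -> ball x D x1 -> ball x D x2 ->
       semiconcave_along K x0 x1 x01 x2 ->
       semiconcave_along (K' (K, r0%:num, r1%:num, r2%:num, D))
         (cone_pt x0 r0) (cone_pt x1 r1) (cone_geodesic x0 r0 x1 r1 x01)
         (cone_pt x2 r2)) /\
  (* (B), with z2 and z0, z1 away from the apex, and with the bound 2 D on the
     distance to x2, automatic at x0 and x1, along the whole of x01: without
     these the claim is false *)
  (exists K' : R * R * R * R -> R,
     {within [set p : R * R * R * R |
                let: (K, r0, r2, D) := p in
                [/\ 0 < r0, 0 < r2 & 0 < D < pi / 2]],
       continuous K'} /\
     forall (X : metricType R) (x0 x1 x2 : X) (r0 r1 r2 : {nonneg R})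
            (x01 : R -> X) (x : X) (D K : R),
       geodesic_space X -> Geod x0 x1 x01 -> D < pi / 2 ->
       ball x D x0 -> ball x D x1 -> ball x D x2 ->
       x0 <> x1 -> r0 = r1 ->
       0 < r0%:num -> 0 < r2%:num ->
       (forall t : R, 0 <= t <= 1 -> mdist x2 (x01 t) <= 2 * D) ->
       semiconcave_along K (cone_pt x0 r0) (cone_pt x1 r1)
         (cone_geodesic x0 r0 x1 r1 x01) (cone_pt x2 r2) ->
       semiconcave_along (K' (K, r0%:num, r2%:num, D)) x0 x1 x01 x2).
Proof.
split.
- exists (fun p => let: (K, r0, r1, r2, D) := p in cone_const K r0 r1 r2 D).
  split=> [|X x0 x1 x2 r0 r1 r2 x01 x D K _ g Dpi xD0 xD1 _]; last first.
    exact: (cone_semiconcave_along _ _ _ g Dpi xD0 xD1).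
  (* On this set every denominator of [cone_const] is nonzero, so continuity at each of its points
     is available. *)
  apply: continuous_in_subspaceT => -[[[[k a] b] c] e]; rewrite inE/=.
  move=> [a0 b0 _ epi].
  suff : cone_const q.1.1.1.1 q.1.1.1.2 q.1.1.2 q.1.2 q.2
      @[q --> ((k, a, b, c, e) : R * R * R * R * R)] --> cone_const k a b c e.
    apply: cvg_trans; apply: near_eq_cvg.
    by apply: filterE => -[[[[? ?] ?] ?] ?].
  apply: cvg_cone_const; rewrite ?gt_eqF//.
  + exact: cvg_comp_fst (cvg_comp_fst (cvg_comp_fst cvg_fst)).
  + exact: cvg_comp_fst (cvg_comp_fst (cvg_comp_fst cvg_snd)).
  + exact: cvg_comp_fst (cvg_comp_fst cvg_snd).
  + exact: cvg_comp_fst cvg_snd.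
  + exact: cvg_snd.
- exists (fun p => let: (K, r0, r2, D) := p in base_const K r0 r2 D).
  split=> [|X x0 x1 x2 r0 r1 r2 x01 x D K _ g Dpi xD0 xD1 _]; last first.
    move=> x_neq r01 r0_gt0 r2_gt0 dD.
    exact: (base_semiconcave_along g Dpi xD0 xD1 x_neq r01 r0_gt0 r2_gt0 dD).
  apply: continuous_in_subspaceT => -[[[k a] c] e]; rewrite inE/=.
  move=> [a0 c0 epi].
  suff : base_const q.1.1.1 q.1.1.2 q.1.2 q.2
      @[q --> ((k, a, c, e) : R * R * R * R)] --> base_const k a c e.
    apply: cvg_trans; apply: near_eq_cvg.
    by apply: filterE => -[[[? ?] ?] ?].
  apply: cvg_base_const; rewrite ?gt_eqF//.
  + exact: cvg_comp_fst (cvg_comp_fst cvg_fst).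
  + exact: cvg_comp_fst (cvg_comp_fst cvg_snd).
  + exact: cvg_comp_fst cvg_snd.
  + exact: cvg_snd.
Qed.
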